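(* Let $\varepsilon>0$. The $L^2$-gradient flow of Mugnai's energy $$\mathcal{W}^{\mathrm{Mu}}_\varepsilon(u)=\frac{1}{2\varepsilon}\int_\Omega\left|\varepsilon\nabla^2u-\frac1\varepsilon W'(u)\,\frac{\nabla u}{|\nabla u|}\otimes\frac{\nabla u}{|\nabla u|}\right|^2dx$$ is equivalent to the phase field system $$\begin{cases}\varepsilon^2\partial_tu=\Delta\mu-\frac{1}{\varepsilon^2}W''(u)\mu+W'(u)\,\mathcal{B}(u),\\[2pt] \mu=W'(u)-\varepsilon^2\Delta u,\end{cases}$$ where $$\mathcal{B}(u)=\operatorname{div}\left(\operatorname{div}\left(\frac{\nabla u}{|\nabla u|}\right)\frac{\nabla u}{|\nabla u|}\right)-\operatorname{div}\left(\nabla\left(\frac{\nabla u}{|\nabla u|}\right)\frac{\nabla u}{|\nabla u|}\right).$$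
   Context: $\Omega\subset\mathbb{R}^N$ is open, bounded, with Lipschitz boundary, and $W(s)=\frac12s^2(1-s)^2$ is the double-well potential. $\nabla^2u$ is the Hessian of $u$, $|M|^2=\sum_{i,j}M_{ij}^2$ for a matrix $M$, $(a\otimes b)_{ij}=a_ib_j$, and for a vector field $\nu$, $\nabla\nu$ is the matrix with entries $(\nabla\nu)_{ij}=\partial_j\nu_i$, so $(\nabla\nu)\nu$ is the derivative of $\nu$ in the direction $\nu$. The $L^2$-gradient of an energy $F$ at $u$ is the function $\nabla F(u)$ such that $\lim_{s\to0}\frac{F(u+sw)-F(u)}{s}=\int_\Omega\nabla F(u)\,w\,dx$ for all $w\in C_c^\infty(\Omega)$. Here $u$ is smooth and $\nabla u\neq0$, so that the expressions involving $\nabla u/|\nabla u|$ make sense. The phrase ''the $L^2$-gradient flow of $F$ is equivalent to an evolution system'' means that, after the constant rescaling of time by the factor $\varepsilon$, the gradient flow of $F$, i.e. $\partial_tu=-\frac1\varepsilon\nabla F(u)$, is exactly the stated system (with $\mu$ eliminated through its defining equation). *)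

(* Defs.v *)
From HB Require Import structures.
From mathcomp Require Import all_boot all_order all_algebra.
From mathcomp Require Import all_classical all_reals all_analysis.
Set Implicit Arguments.
Unset Strict Implicit.
Unset Printing Implicit Defensive.
Import Order.TTheory GRing.Theory Num.Theory.
Import numFieldNormedType.Exports.
Local Open Scope classical_set_scope.
Local Open Scope ring_scope.

(** * Lebesgue measure on R^n

    It lives on [n.-tuple R] with the product sigma-algebra, and is the n-fold
    product of the one-dimensional Lebesgue measure.  Points of R^n are row
    vectors everywhere else; [row_of_tuple] transports the integrals. *)

Definition tuple_cons (R : realType) (n : nat)
    (p : n.-tuple (measurableTypeR R) * measurableTypeR R) :
    n.+1.-tuple (measurableTypeR R) :=
  [the n.+1.-tuple (measurableTypeR R) of p.2 :: p.1].

Fixpoint lebesgue_tuple (R : realType) (n : nat) :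
    set (n.-tuple (measurableTypeR R)) -> \bar R :=
  match n with
  | 0 => dirac [tuple]
  | m.+1 => pushforward (product_measure1 (@lebesgue_tuple R m)
                           (@lebesgue_measure R)) (@tuple_cons R m)
  end.

Lemma measurable_tuple_cons (R : realType) (n : nat) :
  measurable_fun [set: n.-tuple (measurableTypeR R) * measurableTypeR R]
    (@tuple_cons R n).
Proof. by apply: measurable_cons; [exact: measurable_snd|exact: measurable_fst]. Qed.

Lemma lebesgue_tuple_measure (R : realType) (n : nat) :
  exists m : {measure set (n.-tuple (measurableTypeR R)) -> \bar R},
    lebesgue_tuple (n := n) = m.
Proof.
elim: n => [|n [m IHm]]; first by exists (dirac [tuple]).
pose P : {measure set (n.-tuple (measurableTypeR R) * measurableTypeR R) -> \bar R} :=
  product_measure1 m (@lebesgue_measure R).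
exists (measure_function_pushforward__canonical__measure_function_Measure
          P (@measurable_tuple_cons R n)).
by rewrite /= IHm.
Qed.

Lemma lebesgue_tuple0 (R : realType) (n : nat) : @lebesgue_tuple R n set0 = 0%E.
Proof. by have [m ->] := lebesgue_tuple_measure R n; exact: measure0. Qed.

Lemma lebesgue_tuple_ge0 (R : realType) (n : nat) A :
  (0 <= @lebesgue_tuple R n A)%E.
Proof. by have [m ->] := lebesgue_tuple_measure R n; exact: measure_ge0. Qed.

Lemma lebesgue_tuple_sigma_additive (R : realType) (n : nat) :
  semi_sigma_additive (@lebesgue_tuple R n).
Proof.
have [m ->] := lebesgue_tuple_measure R n.
exact: measure_semi_sigma_additive.
Qed.

HB.instance Definition _ (R : realType) (n : nat) :=
  isMeasure.Build _ _ _ (@lebesgue_tuple R n) (lebesgue_tuple0 R n)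
    (@lebesgue_tuple_ge0 R n) (@lebesgue_tuple_sigma_additive R n).

Lemma lebesgue_tuple_box (R : realType) (n : nat) (a b : 'I_n -> R) :
  (forall i, a i <= b i) ->
  lebesgue_tuple [set t | forall i, tnth t i \in `[a i, b i]] =
  (\prod_(i < n) (b i - a i))%:E.
Proof.
elim: n => [|n IHn] in a b * => ab.
  rewrite big_ord0 /= diracE mem_set//=.
  by case.
rewrite /= /pushforward.
set A := [set t : n.-tuple (measurableTypeR R) | forall i,
  tnth t i \in `[a (lift ord0 i), b (lift ord0 i)]].
have mA : measurable A.
  rewrite (_ : A = \bigcap_(i in [set: 'I_n])
    ((fun t : n.-tuple (measurableTypeR R) => tnth t i) @^-1`
      `[a (lift ord0 i), b (lift ord0 i)])); last first.
    apply/seteqP; split => [t h i _|t h i]; [exact: h|exact: (h i I)].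
  apply: fin_bigcap_measurable => // i _.
  have mI : @measurable _ (measurableTypeR R) `[a (lift ord0 i), b (lift ord0 i)].
    exact: measurable_itv.
  by have := @measurable_tnth _ (measurableTypeR R) n i measurableT _ mI; rewrite setTI.
rewrite (_ : _ @^-1` _ = A `*` `[a ord0, b ord0]); last first.
  apply/seteqP; split => -[t x] /=.
    move=> h; split; last by have := h ord0.
    by move=> i; have := h (lift ord0 i); rewrite tnthS.
  move=> [h1 h2] i; case: (unliftP ord0 i) => [j ->|->]; rewrite ?tnthS//.
have mI : @measurable _ (measurableTypeR R) `[a ord0, b ord0].
  exact: measurable_itv.
transitivity (lebesgue_tuple A * lebesgue_measure `[a ord0, b ord0])%E.
  exact: product_measure1E.
have -> := IHn _ _ (fun i => ab (lift ord0 i)).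
rewrite big_ord_recl EFinM muleC; congr (_ * _)%E.
have := @lebesgue_measure_itv R `[a ord0, b ord0]; rewrite /= => ->.
rewrite lte_fin -EFinD; case: ifPn => //.
by rewrite -leNgt => ba; have/eqP -> : a ord0 == b ord0; rewrite ?subrr// eq_le ab.
Qed.

Definition row_of_tuple (R : realType) (n : nat) (t : n.-tuple R) : 'rV[R]_n :=
  \row_i tnth t i.

Definition integral_on (R : realType) (n : nat) (Omega : set 'rV[R]_n)
    (f : 'rV[R]_n -> R) : \bar R :=
  (\int[@lebesgue_tuple R n]_(t in @row_of_tuple R n @^-1` Omega)
     (f (row_of_tuple t))%:E)%E.

Definition integrable_on (R : realType) (n : nat) (Omega : set 'rV[R]_n)
    (f : 'rV[R]_n -> R) : Prop :=
  (@lebesgue_tuple R n).-integrable (@row_of_tuple R n @^-1` Omega)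
    (fun t => (f (row_of_tuple t))%:E).

(** * Domains *)

(* Near each boundary point, in suitable orthonormal coordinates, Omega is the
   part of the space lying strictly above the graph of a Lipschitz function of
   the first n coordinates.  The library's balls and norms on row vectors are
   those of the sup norm, which does not affect the notion. *)
Definition lipschitz_boundary (R : realType) (n : nat)
    (Omega : set 'rV[R]_n.+1) : Prop :=
  forall x0, (closure Omega `\` Omega°) x0 ->
  exists (Q : 'M[R]_n.+1) (r : R) (gamma : 'rV[R]_n -> R),
    [/\ Q *m Q^T = 1%:M, 0 < r, lipschitz gamma &
        forall x, ball x0 r x ->
          Omega x <->
          gamma (col' ord_max (x *m Q)) < (x *m Q) ord0 ord_max].

(** * Differential operators *)

Definition partial (R : realType) (n : nat) (i : 'I_n) (f : 'rV[R]_n -> R) :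
    'rV[R]_n -> R :=
  fun x => 'D_(delta_mx ord0 i) f x.

(* Differentiability of every iterated partial derivative entails the
   continuity of all of them, so this is the usual class C^oo(Omega) when
   Omega is open. *)
Definition smooth_on (R : realType) (n : nat) (Omega : set 'rV[R]_n)
    (f : 'rV[R]_n -> R) : Prop :=
  forall (s : seq 'I_n) x, Omega x ->
    differentiable (foldr (fun i g => partial i g) f s) x.

(* C_c^oo(Omega), its elements being extended by 0 to the whole space *)
Definition test_function (R : realType) (n : nat) (Omega : set 'rV[R]_n)
    (w : 'rV[R]_n -> R) : Prop :=
  smooth_on setT w /\
  exists K : set 'rV[R]_n,
    [/\ compact K, K `<=` Omega & forall x, ~ K x -> w x = 0].

Definition grad (R : realType) (n : nat) (f : 'rV[R]_n -> R) :
    'rV[R]_n -> 'rV[R]_n :=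
  fun x => \row_i partial i f x.

Definition hessian (R : realType) (n : nat) (f : 'rV[R]_n -> R) :
    'rV[R]_n -> 'M[R]_n :=
  fun x => \matrix_(i, j) partial i (partial j f) x.

Definition divergence (R : realType) (n : nat) (nu : 'rV[R]_n -> 'rV[R]_n) :
    'rV[R]_n -> R :=
  fun x => \sum_i partial i (fun y => nu y ord0 i) x.

Definition laplacian (R : realType) (n : nat) (f : 'rV[R]_n -> R) :
    'rV[R]_n -> R :=
  fun x => \sum_i partial i (partial i f) x.

Definition grad_field (R : realType) (n : nat) (nu : 'rV[R]_n -> 'rV[R]_n) :
    'rV[R]_n -> 'M[R]_n :=
  fun x => \matrix_(i, j) partial j (fun y => nu y ord0 i) x.

(* M v, for a vector v written as a row *)
Definition mx_apply (R : realType) (n : nat) (M : 'M[R]_n) (v : 'rV[R]_n) :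
    'rV[R]_n :=
  (M *m v^T)^T.

Definition tensor (R : realType) (n : nat) (a b : 'rV[R]_n) : 'M[R]_n :=
  \matrix_(i, j) (a ord0 i * b ord0 j).

Definition sq_norm_mx (R : realType) (n : nat) (M : 'M[R]_n) : R :=
  \sum_i \sum_j M i j ^+ 2.

(* The library's norm `|v| is the sup norm. *)
Definition euclidean_norm (R : realType) (n : nat) (v : 'rV[R]_n) : R :=
  Num.sqrt (\sum_i v ord0 i ^+ 2).

Definition unit_grad (R : realType) (n : nat) (f : 'rV[R]_n -> R) :
    'rV[R]_n -> 'rV[R]_n :=
  fun x => (euclidean_norm (grad f x))^-1 *: grad f x.

(** * Mugnai's energy and its L^2-gradient flow *)

Definition double_well (R : realType) (s : R) : R :=
  2^-1 * s ^+ 2 * (1 - s) ^+ 2.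

Definition mugnai_energy (R : realType) (n : nat) (Omega : set 'rV[R]_n)
    (eps : R) (u : 'rV[R]_n -> R) : \bar R :=
  (((2 * eps)^-1)%:E *
   integral_on Omega (fun x =>
     sq_norm_mx (eps *: hessian u x -
       (eps^-1 * derive1 (@double_well R) (u x)) *:
         tensor (unit_grad u x) (unit_grad u x))))%E.

(* The difference quotients are taken in \bar R; their convergence to a finite
   limit forces F u and F (u + s w), for small s, to be finite. *)
Definition is_L2_gradient (R : realType) (n : nat) (Omega : set 'rV[R]_n)
    (F : ('rV[R]_n -> R) -> \bar R) (u g : 'rV[R]_n -> R) : Prop :=
  forall w, test_function Omega w ->
    integrable_on Omega (fun x => g x * w x) /\
    ((F (fun x => u x + s * w x)%R - F u) * (s^-1)%:E)%E @[s --> 0^'] -->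
      integral_on Omega (fun x => g x * w x).

Definition time_derivative (R : realType) (n : nat) (u : R -> 'rV[R]_n -> R) :
    R -> 'rV[R]_n -> R :=
  fun t x => derive1 (fun tau => u tau x) t.

(* I is the set of times at which the equation is required. *)
Definition L2_gradient_flow (R : realType) (n : nat) (Omega : set 'rV[R]_n)
    (eps : R) (F : ('rV[R]_n -> R) -> \bar R) (I : set R)
    (u : R -> 'rV[R]_n -> R) : Prop :=
  forall t, I t -> exists2 g : 'rV[R]_n -> R,
    is_L2_gradient Omega F (u t) g &
    forall x, Omega x -> time_derivative u t x = - (eps^-1 * g x).

Definition curvature_term (R : realType) (n : nat) (u : 'rV[R]_n -> R) :
    'rV[R]_n -> R :=
  let nu := unit_grad u in
  fun x => divergence (fun y => divergence nu y *: nu y) x -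
           divergence (fun y => mx_apply (grad_field nu y) (nu y)) x.

Definition phase_field_system (R : realType) (n : nat) (Omega : set 'rV[R]_n)
    (eps : R) (I : set R) (u mu : R -> 'rV[R]_n -> R) : Prop :=
  forall t x, I t -> Omega x ->
    eps ^+ 2 * time_derivative u t x =
      laplacian (mu t) x
      - (eps ^+ 2)^-1 * derive1 (derive1 (@double_well R)) (u t x) * mu t x
      + derive1 (@double_well R) (u t x) * curvature_term (u t) x
    /\ mu t x = derive1 (@double_well R) (u t x) - eps ^+ 2 * laplacian (u t) x.

(* Smooth evolutions whose gradient does not vanish on Omega and whose energy
   is finite.  In time, only the existence of the derivative, and its
   continuity in space, are required. *)
Definition admissible_evolution (R : realType) (n : nat)
    (Omega : set 'rV[R]_n) (F : ('rV[R]_n -> R) -> \bar R) (I : set R)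
    (u : R -> 'rV[R]_n -> R) : Prop :=
  forall t, I t ->
    [/\ smooth_on Omega (u t),
        forall x, Omega x ->
          derivable (fun tau => u tau x) t 1 /\
          {for x, continuous (time_derivative u t)},
        forall x, Omega x -> grad (u t) x != 0 &
        (F (u t) < +oo)%E].

(* Main.v *)
Require Import Defs.
From HB Require Import structures.
From mathcomp Require Import all_boot all_order all_algebra.
From mathcomp Require Import all_classical all_reals all_analysis.
From mathcomp Require Import measurable_realfun ring lra.
Import Order.TTheory GRing.Theory Num.Theory.
Import numFieldNormedType.Exports.
Local Open Scope classical_set_scope.
Local Open Scope ring_scope.

(** Write nu for the unit normal grad u / |grad u|, A for the deficit matrix
    eps Hess u - eps^-1 W'(u) nu (x) nu, so that the energy is the integral of
    |A|^2 / (2 eps), and mu = W'(u) - eps^2 Lap u.  The whole theorem rests on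
    the computation of the L2-gradient of the energy: it is
<<
      g = - eps^-1 (Lap mu - eps^-2 W''(u) mu + W'(u) B(u)),
>>
    and the rescaled flow u_t = - eps^-1 g is then the phase field system,
    multiplied by eps^-2.

    Pointwise computation.  The directional derivative of |A|^2 / (2 eps) along
    w is eps^-1 A : A', where A' collects the variation of the Hessian, of W'(u)
    and of nu (x) nu.  The variation of nu is tangential, and the tangential
    part of A nu is eps |grad u| (grad nu) nu; hence first derivatives of w enter
    only through W'(u) (grad nu) nu . grad w ([first_variation_alg]).
    Moreover div A = Z - 2 eps^-1 W'(u) (grad nu) nu with
<<
      Z = - eps^-1 (grad mu + W'(u) ((div nu) nu - (grad nu) nu)),
>>
    by the symmetry of second derivatives ([div_deficit]).  Together with
    |grad u| div nu = Lap u - nu . (Hess u) nu and nu . (grad nu) nu = 0, this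
    gives eps^-1 A : A' = g w + div (A grad w - w Z)
    ([first_variation_pointwise]).

    Passage to the integral.  For a test function w supported in a compact set K,
    the divergence integrates to 0 ([integralRn_partial_eq0], by Fubini and the
    fundamental theorem of calculus).  On K the gradient of u is bounded away
    from 0, and the density of u + s w is a rational expression of s with
    bounded coefficients, so it has a first-order expansion whose remainder is
    O(s^2) uniformly on K ([jet_density]); outside K it does not depend on s.
    Integrating the expansion over the bounded set K differentiates the energy
    ([mugnai_L2_gradient]).

    Equivalence.  An L2-gradient that is continuous on Omega is unique, by the
    fundamental lemma of the calculus of variations ([fundamental_lemma]), which
    is applied with bumps built from exp (-1/t).  Along a gradient flow the
    gradient is - eps u_t on Omega, hence continuous, hence equal to g. *)

(** * Lebesgue integration of compactly supported continuous functions *)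

Section Measure.
Context {R : realType}.
Implicit Types n : nat.

Lemma row_of_tuple_ball n (a t : n.-tuple R) (e : R) : 0 < e ->
  (forall i, `|tnth a i - tnth t i| < e) ->
  ball (row_of_tuple a) e (row_of_tuple t).
Proof. by move=> e0 h; split=> // i j; rewrite !mxE; exact: h. Qed.

(** The product sigma-algebra is generated by the coordinates, so the open
    set is written as the countable union of the rational cubes contained in it. *)
Lemma measurable_open_row n (U : set 'rV[R]_n) : open U ->
  measurable ((@row_of_tuple R n @^-1` U) : set (n.-tuple (measurableTypeR R))).
Proof.
move=> oU.
pose B (q : n.-tuple rat) (k : nat) : set (n.-tuple (measurableTypeR R)) :=
  [set t | forall i, `|ratr (tnth q i) - tnth t i| < k.+1%:R^-1].
pose P q k := B q k `<=` @row_of_tuple R n @^-1` U.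
have -> : (@row_of_tuple R n @^-1` U) =
    \bigcup_k \bigcup_q (if `[< P q k >] then B q k else set0).
  apply/seteqP; split => [t Ut|t [k _] [q _]]; last first.
    by case: ifPn => // /asboolP; exact.
  have /nbhs_ballP[e /= e0 he] := open_nbhs_nbhs (conj oU Ut).
  (* a cube of half-side 1/(k+1) < e/2 whose center is that close to t
     contains t and lies in the ball of radius e *)
  pose k := Num.truncn (2 / e).
  have ke : k.+1%:R^-1 < e / 2.
    rewrite -[ltRHS]invrK ltf_pV2 ?posrE ?invr_gt0 ?divr_gt0//.
    by rewrite invf_div truncnS_gt.
  have hq i : exists q : rat, `|ratr q - tnth t i| < k.+1%:R^-1.
    have : tnth t i - k.+1%:R^-1 < tnth t i + k.+1%:R^-1.
      by rewrite ltrD2l (@lt_trans _ _ 0)// ?oppr_lt0 invr_gt0.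
    move=> /rat_in_itvoo[q]; rewrite in_itv/= => /andP[q1 q2]; exists q.
    by rewrite ltr_norml; apply/andP; split; [rewrite ltrBrDl|rewrite ltrBlDl].
  exists k => //; exists (mktuple (fun i => sval (cid (hq i)))) => //.
  have tB : B (mktuple (fun i => sval (cid (hq i)))) k t.
    by move=> i; rewrite tnth_mktuple; exact: (svalP (cid (hq i))).
  case: ifPn => // /asboolP; apply: contra_notP => _ t' t'B.
  apply: he; apply: row_of_tuple_ball => // i.
  have := tB i; have := t'B i; move: ke.
  set d := _^-1; set z := ratr _ => h1 h2 h3.
  rewrite (_ : _ - _ = (z - tnth t' i) - (z - tnth t i)); last by ring.
  by rewrite (le_lt_trans (ler_normB _ _))//; lra.
apply: bigcupT_measurable => k.
apply: countable_bigcupT_measurable; first exact: countableP.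
move=> q; case: ifPn => // _.
rewrite /B (_ : mkset _ = \bigcap_(i in [set: 'I_n])
   ((fun t : n.-tuple (measurableTypeR R) => tnth t i) @^-1`
      [set y | `|ratr (tnth q i) - y| < k.+1%:R^-1])); last first.
  by apply/seteqP; split=> [t h i _|t h i]; [exact: h|exact: (h i)].
apply: fin_bigcap_measurable => // i _.
have mI : @measurable _ (measurableTypeR R) [set y | `|ratr (tnth q i) - y| < k.+1%:R^-1].

  exact: measurable_ball.
by have := @measurable_tnth _ (measurableTypeR R) n i measurableT _ mI; rewrite setTI.
Qed.

Lemma measurable_continuous_on n (Omega : set 'rV[R]_n) (f : 'rV[R]_n -> R) :
  open Omega -> (forall x, Omega x -> {for x, continuous f}) ->
  measurable_fun ((@row_of_tuple R n @^-1` Omega)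
      : set (n.-tuple (measurableTypeR R)))
    (fun t => (f (row_of_tuple t))%:E).
Proof.
move=> oO cf; apply/measurable_EFinP.
apply: (measurability _ (RGenOpens.measurableE R)).
move=> _ [_ [a [b ->] <-]].
rewrite -[X in _ `&` X]/(@row_of_tuple R n @^-1` (f @^-1` `]a, b[)).
rewrite -preimage_setI; apply: measurable_open_row.
rewrite openE => x [Ox fx]; apply: filterI; first exact: open_nbhs_nbhs.
apply: (cf x Ox); by apply: open_nbhs_nbhs; split => //; exact: interval_open.
Qed.

Definition tuple_box n (M : R) : set (n.-tuple (measurableTypeR R)) :=
  [set t | forall i, tnth t i \in `[- M, M]].

Lemma measurable_tuple_box n M : measurable (@tuple_box n M).
Proof.
rewrite (_ : @tuple_box n M = \bigcap_(i in [set: 'I_n])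
   ((fun t : n.-tuple (measurableTypeR R) => tnth t i) @^-1` `[- M, M])).
  apply: fin_bigcap_measurable => // i _.
  have mI : @measurable _ (measurableTypeR R) `[- M, M] by exact: measurable_itv.
  by have := @measurable_tnth _ (measurableTypeR R) n i measurableT _ mI;
    rewrite setTI.
by apply/seteqP; split=> [t h i _|t h i]; [exact: h|exact: (h i)].
Qed.

Lemma lebesgue_tuple_box_lty n M : (lebesgue_tuple (@tuple_box n M) < +oo)%E.
Proof.
have [M0|M0] := leP 0 M.
  by rewrite lebesgue_tuple_box ?ltry// => i; rewrite ge0_cp.
rewrite (@le_lt_trans _ _ (lebesgue_tuple (@tuple_box n 0)))//.
  apply: le_measure; rewrite ?inE; [exact: measurable_tuple_box..|].
  move=> t h i; have := h i; rewrite !in_itv/= => /andP[h1 h2].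
  by have := le_trans h1 h2; lra.
by rewrite lebesgue_tuple_box ?ltry// => i; rewrite ge0_cp.
Qed.

(** The cubes [-k, k]^n exhaust the space.  Fubini's theorem is stated for
    sigma-finite measures. *)
Lemma lebesgue_tuple_sigma_finite n : sigma_finite setT (@lebesgue_tuple R n).
Proof.
exists (fun k => @tuple_box n k%:R).
  apply/seteqP; split => // t _.
  pose M : R := \sum_(i < n) `|tnth t i|.
  exists (Num.truncn M).+1 => // i; rewrite in_itv/= -ler_norml.
  apply: le_trans (ltW (truncnS_gt M)).
  by rewrite /M (bigD1 i)//= lerDl sumr_ge0.
by move=> k; split; [exact: measurable_tuple_box|exact: lebesgue_tuple_box_lty].
Qed.

HB.instance Definition _ n := @Measure_isSigmaFinite.Build _ _ _
  (@lebesgue_tuple R n) (lebesgue_tuple_sigma_finite n).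

Lemma coord_le_norm n (x : 'rV[R]_n) i : `|x ord0 i| <= `|x|.
Proof.
rewrite [leRHS]/Num.Def.normr/= mx_normrE.
exact: (@le_bigmax _ _ _ 0 (fun ij => `|x ij.1 ij.2|) (ord0, i)).
Qed.

Lemma norm_le_coord n (x : 'rV[R]_n) M : 0 <= M ->
  (forall i, `|x ord0 i| <= M) -> `|x| <= M.
Proof.
move=> M0 h; rewrite [leLHS]/Num.Def.normr/= mx_normrE.
by apply: bigmax_le => // -[i j] _; rewrite (ord1 i).
Qed.

(** The class C_c(R^n).  Multiplication by a test function brings every
    integrand into it, after which Omega no longer appears in the integrals. *)
Definition Cc n (h : 'rV[R]_n -> R) :=
  continuous h /\ exists M, forall x, M < `|x| -> h x = 0.

Lemma Cc_support n (h : 'rV[R]_n -> R) : Cc n h ->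
  exists2 M : R, 0 <= M & forall t : n.-tuple R, ~ tuple_box n M t ->
    h (row_of_tuple t) = 0.
Proof.
move=> [_ [M hM]]; exists (Num.max 0 M); first by rewrite le_max lexx.
move=> t tB; apply: hM; rewrite ltNge; apply/negP => tM; apply: tB => i.
rewrite in_itv/= -ler_norml le_max; apply/orP; right.
apply: le_trans tM.
by have := coord_le_norm n (row_of_tuple t) i; rewrite mxE.
Qed.

Lemma Cc_bounded n (h : 'rV[R]_n -> R) : Cc n h ->
  exists2 C, 0 <= C & forall x, `|h x| <= C.
Proof.
move=> [ch [M hM]].
pose A := [set x : 'rV[R]_n | `|x| <= M].
have cA : compact A.
  apply: bounded_closed_compact.
    exists M; split; first exact: num_real.
    by move=> e Me x /= xM; rewrite (le_trans xM)// ltW.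
  apply: (@closed_comp _ _ (fun x : 'rV[R]_n => `|x|) [set y : R | y <= M]).
    by move=> x _; exact: norm_continuous.
  exact: closed_le.
have [A0|/set0P[a Aa]] := eqVneq A set0.
  exists 0 => // x; rewrite hM ?normr0// ltNge; apply/negP => xM.
  by have : A x by []; rewrite A0.
have [c _ hc] : exists2 c, c \in A & forall t, t \in A -> `|h t| <= `|h c|.
  apply: EVT_max_rV => //; first by exists a.
  apply: continuous_subspaceT => x.
  apply: (@continuous_comp _ _ _ h (fun y : R => `|y|)); first exact: ch.
  exact: norm_continuous.
exists `|h c| => // x; have [xM|Mx] := leP `|x| M; first by apply: hc; rewrite inE.
by rewrite hM// normr0.
Qed.

Lemma Cc_measurable n (h : 'rV[R]_n -> R) : continuous h ->
  measurable_fun setT (fun t : n.-tuple (measurableTypeR R) => (h (row_of_tuple t))%:E).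
Proof.
move=> ch; rewrite -(preimage_setT (@row_of_tuple R n)).
by apply: measurable_continuous_on => [|x _]; [exact: openT|exact: ch].
Qed.

Lemma Cc_integrable n (h : 'rV[R]_n -> R) : Cc n h ->
  (@lebesgue_tuple R n).-integrable setT (fun t => (h (row_of_tuple t))%:E).
Proof.
move=> hcc; have [M M0 hM] := Cc_support n h hcc.
have [C C0 hC] := Cc_bounded n h hcc.
have mB := measurable_tuple_box n M.
have : (@lebesgue_tuple R n).-integrable (@tuple_box n M)
    (fun t => (h (row_of_tuple t))%:E).
  apply: (@measurable_bounded_integrable _ _ _ _
    (fun t : n.-tuple (measurableTypeR R) => h (row_of_tuple t))) => //.
  - exact: lebesgue_tuple_box_lty.
  - apply/measurable_EFinP; apply: measurable_funTS.
    by apply: Cc_measurable; case: hcc.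
  - exists C; split; first exact: num_real.
    by move=> e Ce t _ /=; rewrite (le_trans (hC _))// ltW.
move/(integrable_mkcond _ mB); congr (integrable _ _ _).
apply/funext => t; rewrite /patch; case: ifPn => //.
by rewrite notin_setE => /hM ->.
Qed.

Definition integralRn n (h : 'rV[R]_n -> R) : R :=
  (\int[@lebesgue_tuple R n]_t h (row_of_tuple t))%R.

Lemma integralRnE n (h : 'rV[R]_n -> R) : Cc n h ->
  (\int[@lebesgue_tuple R n]_t (h (row_of_tuple t))%:E)%E = (integralRn n h)%:E.
Proof.
move=> hcc; rewrite /integralRn /Rintegral fineK//.
by apply: integrable_fin_num => //; exact: Cc_integrable.
Qed.

Lemma CcD n (f g : 'rV[R]_n -> R) : Cc n f -> Cc n g -> Cc n (fun x => f x + g x).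
Proof.
move=> [cf [M hM]] [cg [P hP]]; split.
  by move=> x; apply: continuousD; [exact: cf|exact: cg].
exists (Num.max M P) => x; rewrite gt_max => /andP[Mx Px].
by rewrite hM// hP// addr0.
Qed.

Lemma CcZ n (c : R) (f : 'rV[R]_n -> R) : Cc n f -> Cc n (fun x => c * f x).
Proof.
move=> [cf [M hM]]; split.
  by move=> x; apply: continuousM; [exact: cst_continuous|exact: cf].
by exists M => x Mx; rewrite hM// mulr0.
Qed.

Lemma integralRnD n (f g : 'rV[R]_n -> R) : Cc n f -> Cc n g ->
  integralRn n (fun x => f x + g x) = integralRn n f + integralRn n g.
Proof.
by move=> cf cg; rewrite /integralRn RintegralD//; exact: Cc_integrable.
Qed.

Lemma integralRnZ n (c : R) (f : 'rV[R]_n -> R) : Cc n f ->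
  integralRn n (fun x => c * f x) = c * integralRn n f.
Proof. by move=> cf; rewrite /integralRn RintegralZl//; exact: Cc_integrable. Qed.

Lemma integralRn_sum n m (f : 'I_m -> 'rV[R]_n -> R) : (forall i, Cc n (f i)) ->
  Cc n (fun x => \sum_i f i x) /\
  integralRn n (fun x => \sum_i f i x) = \sum_i integralRn n (f i).
Proof.
elim: m f => [|m IH] f cf.
  split.
    have -> : (fun x => \sum_i f i x) = (fun=> 0).
      by apply/funext => x; rewrite big_ord0.
    by split; [move=> x; exact: cst_continuous|exists 0].
  rewrite big_ord0 /integralRn (_ : (fun t => _) = (fun t => 0)).
    by rewrite /Rintegral integral0.
  by apply/funext => t; rewrite big_ord0.
have [h1 h2] := IH (fun i => f (lift ord0 i)) (fun i => cf _).
have -> : (fun x => \sum_i f i x) =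
    (fun x => f ord0 x + \sum_i f (lift ord0 i) x).
  by apply/funext => x; rewrite big_ord_recl.
by split; [exact: CcD|rewrite integralRnD// h2 big_ord_recl].
Qed.

(** This bound plays the part of dominated convergence when the energy is
    differentiated: a remainder O(s^2) supported in a fixed cube has an integral
    O(s^2). *)
Lemma le_integralRn n (f : 'rV[R]_n -> R) (M C : R) : 0 <= M -> 0 <= C ->
  Cc n f -> (forall x, M < `|x| -> f x = 0) -> (forall x, `|f x| <= C) ->
  `|integralRn n f| <= C * (2 * M) ^+ n.
Proof.
move=> M0 C0 cf fM fC.
have If := Cc_integrable n f cf.
rewrite /integralRn (le_trans (le_normr_Rintegral _ _))//.
have mB := measurable_tuple_box n M.
rewrite -lee_fin /Rintegral fineK; last first.
  by apply: integrable_fin_num => //; apply: (@integrable_norm _ _ _ _ _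
    (fun t : n.-tuple (measurableTypeR R) => f (row_of_tuple t))).
apply: (@le_trans _ _ (\int[@lebesgue_tuple R n]_(t in @tuple_box n M) C%:E)%E).
  rewrite [leRHS]integral_mkcond; apply: ge0_le_integral => //.
  - apply/measurable_EFinP; apply: measurableT_comp => //.
    by apply/measurable_EFinP; apply: Cc_measurable; case: cf.
  - apply/(measurable_restrictT _ mB); exact: measurable_cst.
  - move=> t _; rewrite /patch; case: ifPn => [_|]; first by rewrite lee_fin.
    rewrite notin_setE => tB; rewrite fM ?normr0// ltNge; apply/negP => tM.
    apply: tB => i; rewrite in_itv/= -ler_norml; apply: le_trans tM.
    by have := coord_le_norm n (row_of_tuple t) i; rewrite mxE.
rewrite integral_cst// [X in (_ * X)%E](_ : _ = (\prod_(i < n) (M - - M))%:E);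
  last exact: @lebesgue_tuple_box R n (fun=> - M) (fun=> M) (fun=> (ge0_cp M0).2).
by rewrite -EFinM prodr_const card_ord opprK -mulr2n mulr_natl.
Qed.

End Measure.

(** * Integration of a partial derivative *)

(** A directional derivative depends only on the increments along a line; the
    derivatives of slices of a function are thereby partial derivatives of the
    function. *)
Section Growth.
Context {R : numFieldType} {V1 V2 W : normedModType R}.
Variables (f1 : V1 -> W) (f2 : V2 -> W) (a1 v1 : V1) (a2 v2 : V2).
Hypothesis growth : forall h, f1 (h *: v1 + a1) - f1 a1 = f2 (h *: v2 + a2) - f2 a2.

Let growthE : (fun h => h^-1 *: ((f1 \o shift a1) (h *: v1) - f1 a1)) =
              (fun h => h^-1 *: ((f2 \o shift a2) (h *: v2) - f2 a2)).
Proof. by apply/funext => h /=; rewrite growth. Qed.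

Lemma derive_eq_growth : 'D_v1 f1 a1 = 'D_v2 f2 a2.
Proof. by rewrite /derive growthE. Qed.

Lemma derivable_eq_growth : derivable f1 a1 v1 -> derivable f2 a2 v2.
Proof. by rewrite /derivable growthE. Qed.
End Growth.

Section DivThm.
Context {R : realType}.
Implicit Types n : nat.

(** The new coordinate comes first, as in [tuple_cons], so that slicing follows
    the recursive construction of the measure. *)
Definition row_cons n (x : R) (v : 'rV[R]_n) : 'rV[R]_n.+1 :=
  \row_i oapp (fun j => v ord0 j) x (unlift ord0 i).

Lemma row_cons0 n x (v : 'rV[R]_n) : row_cons n x v ord0 ord0 = x.
Proof. by rewrite mxE unlift_none. Qed.

Lemma row_consS n x (v : 'rV[R]_n) j : row_cons n x v ord0 (lift ord0 j) = v ord0 j.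
Proof. by rewrite mxE liftK. Qed.

Lemma row_of_tuple_cons n (p : n.-tuple (measurableTypeR R) * measurableTypeR R) :
  row_of_tuple (tuple_cons p) = row_cons n p.2 (row_of_tuple p.1).
Proof.
apply/rowP => i; case: (unliftP ord0 i) => [j ->|->].
  by rewrite row_consS !mxE tnthS.
by rewrite row_cons0 mxE.
Qed.

Lemma row_cons_shift0 n (v : 'rV[R]_n) s t :
  row_cons n (s + t) v = s *: delta_mx ord0 ord0 + row_cons n t v.
Proof.
apply/rowP => i; case: (unliftP ord0 i) => [j ->|->].
  by rewrite row_consS !mxE liftK/= mulr0 add0r.
by rewrite row_cons0 !mxE unlift_none/= mulr1.
Qed.

Lemma row_cons_shiftS n (v : 'rV[R]_n) x s j :
  row_cons n x (s *: delta_mx ord0 j + v) =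
  s *: delta_mx ord0 (lift ord0 j) + row_cons n x v.
Proof.
apply/rowP => i; case: (unliftP ord0 i) => [k ->|->].
  by rewrite row_consS !mxE liftK/= (inj_eq lift_inj).
by rewrite row_cons0 !mxE unlift_none/= mulr0 add0r.
Qed.

Lemma derive_row_cons0 n (h : 'rV[R]_n.+1 -> R) v s :
  'D_1 (fun s => h (row_cons n s v)) s = partial ord0 h (row_cons n s v).
Proof. by apply: derive_eq_growth => t; rewrite row_cons_shift0 [t *: 1]mulr1. Qed.

Lemma derivable_row_cons0 n (h : 'rV[R]_n.+1 -> R) v s :
  derivable h (row_cons n s v) (delta_mx ord0 ord0) ->
  derivable (fun s => h (row_cons n s v)) s 1.
Proof.
apply: derivable_eq_growth => t.
by rewrite -row_cons_shift0 [t *: 1]mulr1.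
Qed.

Lemma partial_row_consS n (h : 'rV[R]_n.+1 -> R) x v j :
  partial j (fun v => h (row_cons n x v)) v =
  partial (lift ord0 j) h (row_cons n x v).
Proof. by apply: derive_eq_growth => t; rewrite row_cons_shiftS. Qed.

Lemma derivable_row_consS n (h : 'rV[R]_n.+1 -> R) x v j :
  derivable h (row_cons n x v) (delta_mx ord0 (lift ord0 j)) ->
  derivable (fun v => h (row_cons n x v)) v (delta_mx ord0 j).
Proof. by apply: derivable_eq_growth => t; rewrite -row_cons_shiftS. Qed.

Lemma row_cons_ball n x x' v v' (e : R) : ball x e x' -> ball v e v' ->
  ball (row_cons n x v) e (row_cons n x' v').
Proof.
move=> bx [e0 bv]; split => // i j; rewrite (ord1 i).
case: (unliftP ord0 j) => [k ->|->]; first by rewrite !row_consS.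
by rewrite !row_cons0.
Qed.

Lemma norm_row_cons_l n (x : R) v : `|x| <= `|row_cons n x v|.
Proof. by have := coord_le_norm _ (row_cons n x v) ord0; rewrite row_cons0. Qed.

Lemma norm_row_cons_r n (x : R) (v : 'rV[R]_n) : `|v| <= `|row_cons n x v|.
Proof.
apply: norm_le_coord => // i.
by have := coord_le_norm _ (row_cons n x v) (lift ord0 i); rewrite row_consS.
Qed.

Lemma continuous_row_consr n x : continuous (@row_cons n x).
Proof.
move=> v; apply/(@cvgrPdist_lt _ _ _ (nbhs v) (nbhs_filter v)) => e e0.
have := nbhsx_ballx v e e0; apply: filterS => v' bv.
have : ball (row_cons n x v) e (row_cons n x v').
  by apply: row_cons_ball => //; exact: ballxx.
by rewrite -ball_normE.
Qed.

Lemma continuous_row_consl n v : continuous (fun x => @row_cons n x v).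
Proof.
move=> s; apply/cvgrPdist_lt => e e0.
have := nbhsx_ballx s e e0; apply: filterS => s' bs.
have : ball (row_cons n s v) e (row_cons n s' v).
  by apply: row_cons_ball => //; exact: ballxx.
by rewrite -ball_normE.
Qed.

Lemma Cc_row_cons n (h : 'rV[R]_n.+1 -> R) x : Cc _ h ->
  Cc n (fun v => h (row_cons n x v)).
Proof.
move=> [ch [M hM]]; split.
  move=> v; apply: (@continuous_comp _ _ _ (row_cons n x) h); last exact: ch.
  exact: continuous_row_consr.
exists M => v Mv; apply: hM; apply: lt_le_trans Mv _; exact: norm_row_cons_r.
Qed.

Section FubiniStep.
Variables (n : nat) (h : 'rV[R]_n.+1 -> R).
Hypothesis hcc : Cc _ h.
Local Open Scope ereal_scope.

Let P := (product_measure1 (@lebesgue_tuple R n) (@lebesgue_measure R)).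
Let H (p : n.-tuple (measurableTypeR R) * measurableTypeR R) : \bar R :=
  (h (row_cons n p.2 (row_of_tuple p.1)))%:E.
Let HE : (fun t => (h (row_of_tuple t))%:E) \o @tuple_cons R n = H.
Proof. by apply/funext => p /=; rewrite row_of_tuple_cons. Qed.

Let intH : P.-integrable setT H.
Proof.
have mf := Cc_measurable _ h hcc.1.
apply/integrableP; split.
  rewrite -HE; apply: measurableT_comp => //; exact: measurable_tuple_cons.
have /integrableP[_] := Cc_integrable _ h hcc.
rewrite (@ge0_integral_pushforward _ _ _ _ R _ (@measurable_tuple_cons R n) P setT
  (fun t => `|(h (row_of_tuple t))%:E|))//.
  by rewrite preimage_setT -HE.
exact: measurableT_comp.
Qed.

Lemma integralRn_prod : (integralRn _ h)%:E = \int[P]_p H p.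
Proof.
have mf := Cc_measurable _ h hcc.1.
rewrite -integralRnE// -HE.
have := @integral_pushforward _ _ _ _ R _ (@measurable_tuple_cons R n) P setT _ mf.
by rewrite preimage_setT HE => /(_ intH measurableT).
Qed.

(** For a derivative in the first coordinate the inner integral must run over
    that coordinate; for the others, over the remaining ones.  Hence the two
    orders of integration. *)
Lemma integralRn_iter1 : (integralRn _ h)%:E =
  \int[@lebesgue_tuple R n]_t \int[lebesgue_measure]_(x in [set: R])
     (h (row_cons n x (row_of_tuple t)))%:E.
Proof. by rewrite integralRn_prod -(integral12_prod_meas1 intH). Qed.

Lemma integralRn_iter2 : (integralRn _ h)%:E =
  \int[lebesgue_measure]_(x in [set: R]) (integralRn _ (fun v => h (row_cons n x v)))%:E.
Proof.
rewrite integralRn_prod -(integral21_prod_meas1 intH).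
by apply: eq_integral => x _; rewrite -integralRnE//; exact: Cc_row_cons.
Qed.
End FubiniStep.

(** Fundamental theorem of calculus on an interval [-L, L] that contains the
    support of g in its interior. *)
Lemma integral_derive_eq0 (g k : R -> R) (M : R) :
  (forall s, derivable g s 1) -> (forall s, 'D_1 g s = k s) -> continuous k ->
  (forall s, M < `|s| -> g s = 0) ->
  (\int[lebesgue_measure]_(x in [set: R]) (k x)%:E)%E = 0%E.
Proof.
move=> dg gk ck gM.
pose L := Num.max M 0 + 1.
have ML : M < L by rewrite /L ltr_pwDr// le_max lexx.
have L0 : 0 < L by rewrite /L ltr_pwDr// le_max lexx orbT.
have kM s : M < `|s| -> k s = 0.
  move=> Ms; rewrite -gk (@near_eq_derive _ _ _ _ (cst 0)) ?derive_cst//.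
  near=> t; apply: gM; near: t.
  have : (fun t : R => `|t|) @ s --> `|s| by exact: norm_continuous.
  by move/cvgr_gt; exact.
rewrite (_ : (fun x => _) = (fun x => (k x)%:E) \_ `[- L, L]); last first.
  apply/funext => x; rewrite patchE; case: ifPn => //; rewrite notin_setE/=.
  move/negP; rewrite in_itv/= -ler_norml -ltNge => Lx.
  by rewrite kM// (lt_trans ML).
rewrite -integral_mkcond (@continuous_FTC2 _ k g).
- by rewrite !gM ?subee// ?normrN gtr0_norm.
- by rewrite gtrN.
- exact: continuous_subspaceT.
- have cg : continuous g.
    by move=> s; apply: differentiable_continuous; apply/derivable1_diffP.
  split; first by move=> x _; exact: dg.
    by apply: cvg_at_right_filter; exact: cg.
  by apply: cvg_at_left_filter; exact: cg.
- by move=> x _; rewrite derive1E gk.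
Unshelve. all: by end_near. Qed.

(** Induction on the dimension.  The derivative in the first coordinate
    integrates to 0 along each line; a derivative in another coordinate is a
    derivative of each slice, to which the induction hypothesis applies. *)
Theorem integralRn_partial_eq0 n (i : 'I_n) (h : 'rV[R]_n -> R) :
  (forall x, derivable h x (delta_mx ord0 i)) -> Cc n (partial i h) ->
  (exists M, forall x, M < `|x| -> h x = 0) ->
  integralRn n (partial i h) = 0.
Proof.
elim: n => [|n IH] in i h *; first by case: i.
move=> dh cph [M hM]; apply: EFin_inj.
case: (unliftP ord0 i) => [j|] iE; rewrite iE in dh cph *.
  rewrite integralRn_iter2//; apply: integral0_eq => x _.
  rewrite (_ : integralRn n _ = 0)//.
  have := IH j (fun v => h (row_cons n x v)).
  have -> : partial j (fun v => h (row_cons n x v)) =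
      fun v => partial (lift ord0 j) h (row_cons n x v).
    by apply/funext => v; rewrite partial_row_consS.
  apply; first by move=> v; apply: derivable_row_consS; exact: dh.
    exact: (Cc_row_cons _ (partial (lift ord0 j) h)).
  by exists M => v Mv; apply: hM; apply: lt_le_trans Mv _; exact: norm_row_cons_r.
rewrite integralRn_iter1//; apply: integral0_eq => t _.
apply: (@integral_derive_eq0 (fun s => h (row_cons n s (row_of_tuple t))) _ M).
- by move=> s; apply: derivable_row_cons0; exact: dh.
- by move=> s; rewrite derive_row_cons0.
- move=> s; apply: (@continuous_comp _ _ _ (fun s => row_cons n s (row_of_tuple t))).
    exact: continuous_row_consl.
  exact: cph.1.
- by move=> s Ms; apply: hM; apply: lt_le_trans Ms _; exact: norm_row_cons_l.
Qed.

End DivThm.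

(** * Smooth functions of several variables *)

(** The functions of the theorem are controlled on Omega only and arbitrary
    elsewhere, so every rule of calculus has to be available up to local
    equality. *)
Lemma near_eq_differentiable (K : numFieldType) (V W : normedModType K)
  (f g : V -> W) (a : V) :
  {near a, f =1 g} -> differentiable f a -> differentiable g a.
Proof.
move=> fg df; have fa := nbhs_singleton fg.
have [cd dE] := (diff_locallyP _ _).1 df.
have gE : g \o shift a = cst (g a) + 'd f a +o_ 0 id.
  apply/eqaddoP => e e0.
  have /eqaddoP/(_ _ e0) := dE.
  have : \forall x \near 0, f (x + a) = g (x + a).
    by move: fg; rewrite (near_shift 0)/=; apply: filterS => x /=;
      rewrite subr0.
  apply: filterS2 => x fgx; rewrite /= !fctE fgx.
  by rewrite /cst fa.
have ddE := diff_unique cd gE.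
by apply/diff_locallyP; rewrite ddE; split.
Qed.

Section Calculus.
Context {R : realType} {n : nat}.
Implicit Types (f g : 'rV[R]_n -> R) (Omega : set 'rV[R]_n).

Lemma partial_near_eq f g i (a : 'rV[R]_n) :
  {near a, f =1 g} -> partial i f a = partial i g a.
Proof. by move=> fg; apply: near_eq_derive. Qed.

Lemma partialD {f g i a} : differentiable f a -> differentiable g a ->
  partial i (fun x => f x + g x) a = partial i f a + partial i g a.
Proof. by move=> df dg; apply: deriveD; exact: diff_derivable. Qed.

Lemma partialB {f g i a} : differentiable f a -> differentiable g a ->
  partial i (fun x => f x - g x) a = partial i f a - partial i g a.
Proof. by move=> df dg; apply: deriveB; exact: diff_derivable. Qed.

Lemma partialM {f g i a} : differentiable f a -> differentiable g a ->
  partial i (fun x => f x * g x) a = f a * partial i g a + g a * partial i f a.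
Proof. by move=> df dg; apply: deriveM; exact: diff_derivable. Qed.

Lemma partial_cst c i a : partial i (fun _ : 'rV[R]_n => c) a = 0.
Proof. exact: derive_cst. Qed.

Lemma partialZ {c f i a} : differentiable f a ->
  partial i (fun x => c * f x) a = c * partial i f a.
Proof.
move=> df; rewrite partialM//; by rewrite partial_cst mulr0 addr0.
Qed.

Lemma sum_funE m (f : 'I_m -> 'rV[R]_n -> R) :
  (fun x => \sum_i f i x) = \sum_i f i.
Proof. by apply/funext => x; rewrite fct_sumE. Qed.

Lemma partial_sum m (f : 'I_m -> 'rV[R]_n -> R) i a :
  (forall k, differentiable (f k) a) ->
  partial i (fun x => \sum_k f k x) a = \sum_k partial i (f k) a.
Proof.
move=> df; rewrite /partial sum_funE derive_sum// => k; exact: diff_derivable.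
Qed.

Lemma differentiable_comp1 (phi : R -> R) f a :
  derivable phi (f a) 1 -> differentiable f a -> differentiable (fun x => phi (f x)) a.
Proof.
by move=> /derivable1_diffP dphi df; exact: (@differentiable_comp _ _ _ _ f phi).
Qed.

Lemma partial_comp1 (phi : R -> R) f i a :
  derivable phi (f a) 1 -> differentiable f a ->
  partial i (fun x => phi (f x)) a = 'D_1 phi (f a) * partial i f a.
Proof.
move=> dphi df; have dphi' : differentiable phi (f a) by exact/derivable1_diffP.
rewrite /partial (deriveE _ df) deriveE; last exact: differentiable_comp1.
have /(congr1 (fun F => F (delta_mx ord0 i))) := diff_comp df dphi'.
rewrite /= => ->.
by rewrite -[in LHS](mulr1 ('d f a _)) [LHS]linearZ/= deriveE// mulrC.
Qed.

(** Smoothness truncated to k + 1 differentiations, recursively in the outermost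
    derivatives: closure properties are proved by induction on k. *)
Fixpoint diff_upto Omega k f : Prop :=
  (forall x, Omega x -> differentiable f x) /\
  (if k is k'.+1 then forall i, diff_upto Omega k' (partial i f) else True).

Lemma diff_uptoW Omega k f : diff_upto Omega k.+1 f -> diff_upto Omega k f.
Proof.
elim: k f => [|k IH] f [h1 h2]; first by split.
by split=> // i; apply: IH; exact: h2.
Qed.

Lemma smooth_partial {Omega f i} : smooth_on Omega f -> smooth_on Omega (partial i f).
Proof. by move=> sf s x Ox; have := sf (rcons s i) x Ox; rewrite foldr_rcons. Qed.

Lemma smooth_diff {Omega f x} : smooth_on Omega f -> Omega x -> differentiable f x.
Proof. by move=> sf; exact: (sf [::] x). Qed.

Lemma smooth_onP Omega f : smooth_on Omega f <-> forall k, diff_upto Omega k f.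
Proof.
split=> [sf k|df].
  elim: k f sf => [|k IH] f sf; split=> //; try exact: (sf [::]).
  by move=> i; apply: IH; exact: smooth_partial.
suff H s g : diff_upto Omega (size s) g -> forall x, Omega x ->
    differentiable (foldr (fun i g => partial i g) g s) x.
  by move=> s x Ox; exact: H.
elim/last_ind: s g => [|s i IH] g; first by case.
by rewrite size_rcons foldr_rcons => -[_ dg]; apply: IH; exact: dg.
Qed.

Section Closure.
Context {Omega : set 'rV[R]_n} (oO : open Omega).

Lemma open_near_eq f g a : {in Omega, f =1 g} -> Omega a -> {near a, f =1 g}.
Proof.
move=> fg Oa; have := open_nbhs_nbhs (conj oO Oa); apply: filterS => x Ox.
by apply: fg; rewrite inE.
Qed.

Lemma partial_in {f g i a} : Omega a -> {in Omega, f =1 g} ->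
  partial i f a = partial i g a.
Proof. by move=> Oa fg; apply: partial_near_eq; exact: open_near_eq. Qed.

Lemma diff_upto_ext k f g : {in Omega, f =1 g} -> diff_upto Omega k f -> diff_upto Omega k g.
Proof.
elim: k f g => [|k IH] f g fg [df pf]; split=> //.
- by move=> x Ox; apply: (near_eq_differentiable _ _ _ f) (df x Ox); exact: open_near_eq.
- by move=> x Ox; apply: (near_eq_differentiable _ _ _ f) (df x Ox); exact: open_near_eq.
move=> i; apply: IH (pf i) => x; rewrite inE => Ox; exact: partial_in.
Qed.

Lemma smooth_ext f g : {in Omega, f =1 g} -> smooth_on Omega f -> smooth_on Omega g.
Proof.
move=> fg /smooth_onP sf; apply/smooth_onP => k; exact: diff_upto_ext (sf k).
Qed.

Lemma diff_upto_cst k c : diff_upto Omega k (fun=> c).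
Proof.
elim: k c => [|k IH] c; split=> //; try by move=> x _; exact: differentiable_cst.
move=> i; rewrite (_ : partial i _ = fun=> 0); first exact: IH.
by apply/funext => x; rewrite partial_cst.
Qed.

Lemma smooth_cst c : smooth_on Omega (fun=> c).
Proof. by apply/smooth_onP => k; exact: diff_upto_cst. Qed.

Lemma diff_uptoD k f g : diff_upto Omega k f -> diff_upto Omega k g ->
  diff_upto Omega k (fun x => f x + g x).
Proof.
elim: k f g => [|k IH] f g [df pf] [dg pg]; split=> //;
  try by move=> x Ox; apply: differentiableD; [exact: df|exact: dg].
move=> i; apply: (diff_upto_ext _ (fun x => partial i f x + partial i g x)).
  by move=> x; rewrite inE => Ox; rewrite partialD//; [exact: df|exact: dg].
by apply: IH; [exact: pf|exact: pg].
Qed.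

Lemma smoothD f g : smooth_on Omega f -> smooth_on Omega g ->
  smooth_on Omega (fun x => f x + g x).
Proof.
by move=> /smooth_onP sf /smooth_onP sg; apply/smooth_onP => k; exact: diff_uptoD.
Qed.

Lemma diff_uptoM k f g : diff_upto Omega k f -> diff_upto Omega k g ->
  diff_upto Omega k (fun x => f x * g x).
Proof.
elim: k f g => [|k IH] f g [df pf] [dg pg]; split=> //;
  try by move=> x Ox; apply: differentiableM; [exact: df|exact: dg].
move=> i; apply: (diff_upto_ext _ (fun x => f x * partial i g x + g x * partial i f x)).
  by move=> x; rewrite inE => Ox; rewrite partialM//; [exact: df|exact: dg].
have Df : diff_upto Omega k f by apply: diff_uptoW; split.
have Dg : diff_upto Omega k g by apply: diff_uptoW; split.
by apply: diff_uptoD; apply: IH => //; [exact: pg|exact: pf].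
Qed.

Lemma smoothM f g : smooth_on Omega f -> smooth_on Omega g ->
  smooth_on Omega (fun x => f x * g x).
Proof.
by move=> /smooth_onP sf /smooth_onP sg; apply/smooth_onP => k; exact: diff_uptoM.
Qed.

Lemma smoothZ c f : smooth_on Omega f -> smooth_on Omega (fun x => c * f x).
Proof. by move=> sf; apply: smoothM => //; exact: smooth_cst. Qed.

Lemma smoothN f : smooth_on Omega f -> smooth_on Omega (fun x => - f x).
Proof.
move=> sf; apply: (smooth_ext (fun x => -1 * f x)); last exact: smoothZ.
by move=> x _; rewrite mulN1r.
Qed.

Lemma smoothB f g : smooth_on Omega f -> smooth_on Omega g ->
  smooth_on Omega (fun x => f x - g x).
Proof. by move=> sf sg; apply: smoothD => //; exact: smoothN. Qed.

Lemma smoothX f m : smooth_on Omega f -> smooth_on Omega (fun x => f x ^+ m).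
Proof.
move=> sf; elim: m => [|m IH]; first exact: smooth_cst.
by apply: (smooth_ext (fun x => f x * f x ^+ m)) => [x _|];
  [rewrite exprS|exact: smoothM].
Qed.

Lemma smooth_sum m (f : 'I_m -> 'rV[R]_n -> R) :
  (forall k, smooth_on Omega (f k)) -> smooth_on Omega (fun x => \sum_k f k x).
Proof.
elim: m f => [|m IH] f sf.
  by apply: (smooth_ext (fun=> 0)) => [x _|]; [rewrite big_ord0|exact: smooth_cst].
apply: (smooth_ext (fun x => f ord0 x + \sum_k f (lift ord0 k) x)).
  by move=> x _; rewrite big_ord_recl.
by apply: smoothD => //; apply: IH.
Qed.

Lemma smooth_coord i : smooth_on Omega (fun x => x ord0 i).
Proof.
apply/smooth_onP => -[|k]; split=> //;
  try by move=> x _; exact: differentiable_coord.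
move=> j; rewrite (_ : partial j _ = fun=> (j == i)%:R); first exact: diff_upto_cst.
apply/funext => x; rewrite /partial.
have E := @derive_mx R 'rV[R]_n 1 n id x (delta_mx ord0 j) (@derivable_id _ _ _ _).
have := congr1 (fun M : 'rV[R]_n => M ord0 i) E; rewrite derive_id [RHS]mxE => E'.
by apply: (etrans (esym E')); rewrite mxE eq_sym.
Qed.

(** The derivative of one member of the family is a combination of later
    members, so the induction on the order of differentiability proceeds for all
    m at once.  The two instances are the negative powers of a square root and
    the functions [theta]. *)
Lemma smooth_comp_family (phi : nat -> R -> R) (U : set R) (a b : nat -> R) f :
  (forall m y, U y -> is_derive y 1 (phi m) (a m * phi m.+1 y + b m * phi m.+2 y)) ->
  (forall x, Omega x -> U (f x)) -> smooth_on Omega f ->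
  forall m, smooth_on Omega (fun x => phi m (f x)).
Proof.
move=> dphi fU sf m; apply/smooth_onP => k.
have /smooth_onP df := sf.
elim: k m => [|k IH] m.
  split=> // x Ox; apply: differentiable_comp1; last exact: smooth_diff sf Ox.
  by have [] := dphi m _ (fU x Ox).
split=> [x Ox|i].
  apply: differentiable_comp1; last exact: smooth_diff sf Ox.
  by have [] := dphi m _ (fU x Ox).
apply: (diff_upto_ext _ (fun x => (a m * phi m.+1 (f x) + b m * phi m.+2 (f x)) *
   partial i f x)).
  move=> x; rewrite inE => Ox; have [dm dE] := dphi m _ (fU x Ox).
  by rewrite partial_comp1 ?dE//; exact: smooth_diff sf Ox.
apply: diff_uptoM; last by have /smooth_onP := smooth_partial (i := i) sf; exact.
by apply: diff_uptoD; apply: diff_uptoM;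
  [exact: diff_upto_cst|exact: IH|exact: diff_upto_cst|exact: IH].
Qed.

Lemma smooth_rsqrt f m : (forall x, Omega x -> 0 < f x) -> smooth_on Omega f ->
  smooth_on Omega (fun x => (Num.sqrt (f x))^-1 ^+ m).
Proof.
move=> f0 sf.
apply: (smooth_comp_family (fun m y => (Num.sqrt y)^-1 ^+ m) [set y | 0 < y]
  (fun=> 0) (fun m => - (m%:R / 2)) f) => // {}m y /= y0.
have s0 : Num.sqrt y != 0 by rewrite gt_eqF// sqrtr_gt0.
have dsq := is_derive1_sqrt y0.
have dV : is_derive y 1 (fun y => (Num.sqrt y)^-1) (- (2^-1 * (Num.sqrt y)^-1 ^+ 3)).
  have [d1 d2] := dsq.
  apply: DeriveDef; first exact: derivableV.
  by rewrite deriveV// d2 /GRing.scale/=; field.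
have -> : (fun y : R => (Num.sqrt y)^-1 ^+ m) = (fun y => (Num.sqrt y)^-1) ^+ m.
  by apply/funext => z; rewrite exprfctE.
apply: is_derive_eq; first exact: (is_deriveX m dV).
rewrite mul0r add0r /GRing.scale/=; case: m => [|m].
  by rewrite !mul0r oppr0 mul0r.
by rewrite /= !exprS; ring.
Qed.

End Closure.

Lemma diff_upto_extend0 {Omega} (K : set 'rV[R]_n) k f : closed K -> K `<=` Omega ->
  (forall x, ~ K x -> f x = 0) -> diff_upto Omega k f -> diff_upto setT k f.
Proof.
move=> cK KO; have near0 g x : (forall x, ~ K x -> g x = 0) -> ~ K x ->
    {near x, g =1 (fun=> 0)}.
  move=> g0 Kx; have oK : open (~` K) by rewrite openC.
  by have := open_nbhs_nbhs (conj oK Kx); apply: filterS => y Ky; exact: g0.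
have dT g : (forall x, ~ K x -> g x = 0) ->
    (forall x, Omega x -> differentiable g x) -> forall x, differentiable g x.
  move=> g0 dg x; have [Kx|Kx] := pselect (K x); first exact/dg/KO.
  apply: (near_eq_differentiable _ _ _ (fun=> 0)); last exact: differentiable_cst.
  by have := near0 g x g0 Kx; apply: filterS => y ->.
elim: k f => [|k IH] f f0 [df pf]; split => //; try by move=> x _; exact: dT.
move=> i; apply: IH; last exact: pf.
move=> x Kx; rewrite (partial_near_eq f (fun=> 0)); first exact: partial_cst.
exact: near0.
Qed.

(** Around a point outside K, which is closed, f vanishes identically. *)
Lemma smooth_extend0 {Omega} {K : set 'rV[R]_n} {f} : closed K -> K `<=` Omega ->
  (forall x, ~ K x -> f x = 0) -> smooth_on Omega f -> smooth_on setT f.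
Proof.
move=> cK KO f0 /smooth_onP sf; apply/smooth_onP => k.
exact: (diff_upto_extend0 K _ _ cK KO f0 (sf k)).
Qed.

Lemma partial_support {K : set 'rV[R]_n} {f} i : closed K ->
  (forall x, ~ K x -> f x = 0) -> forall x, ~ K x -> partial i f x = 0.
Proof.
move=> cK f0 x Kx; rewrite (partial_near_eq f (fun=> 0)); first exact: partial_cst.
have oK : open (~` K) by rewrite openC.
by have := open_nbhs_nbhs (conj oK Kx); apply: filterS => y Ky; exact: f0.
Qed.

End Calculus.

(** * Symmetry of second derivatives *)

Section Schwarz.
Context {R : realType} {V : normedModType R}.
Implicit Types (f : V -> R) (a v w : V).

Lemma growth_along f a v (s t : R) :
  f (a + (t *: (1 : R^o) + s) *: v) - f (a + s *: v) =
  f (t *: v + (a + s *: v)) - f (a + s *: v).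
Proof. by rewrite [t *: 1]mulr1 scalerDl addrCA. Qed.

Lemma derive_along f a v (s : R) :
  'D_1 (fun s : R => f (a + s *: v)) s = 'D_v f (a + s *: v).
Proof.
by apply: derive_eq_growth => t; rewrite growth_along.
Qed.

Lemma derivable_along f a v (s : R) : derivable f (a + s *: v) v ->
  derivable (fun s : R => f (a + s *: v)) s 1.
Proof.
apply: derivable_eq_growth => t.
by rewrite -growth_along.
Qed.

Lemma MVT_along f a v (h : R) : 0 < h ->
  (forall s : R, 0 <= s <= h -> derivable f (a + s *: v) v) ->
  exists2 s : R, 0 < s < h & f (a + h *: v) - f a = h * 'D_v f (a + s *: v).
Proof.
move=> h0 df; pose g (s : R) := f (a + s *: v).
have dg s : 0 <= s <= h -> derivable g s 1 by move=> sh; exact/derivable_along/df.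
have [] := @MVT R g (fun s : R => 'D_v f (a + s *: v)) 0 h h0.
- move=> s; rewrite in_itv/= => /andP[s0 sh]; apply: DeriveDef.
    by apply: dg; rewrite !ltW.
  by rewrite derive_along.
- apply: derivable_within_continuous => s; rewrite in_itv/=; exact: dg.
move=> s; rewrite in_itv/= => sh E; exists s => //.
by move: E; rewrite /g scale0r addr0 subr0 mulrC.
Qed.

(** The mean value theorem along v for the increment in the direction w, then
    along w for the derivative 'D_v f.  The left-hand side is symmetric in v and
    w, which is what makes the mixed derivatives commute. *)
Lemma second_difference f a v w (h : R) : 0 < h ->
  (forall s t : R, 0 <= s <= h -> 0 <= t <= h ->
    differentiable f (a + s *: v + t *: w) /\
    differentiable ('D_v f) (a + s *: v + t *: w)) ->
  exists s t : R, [/\ 0 < s < h, 0 < t < h &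
    f (a + h *: v + h *: w) - f (a + h *: v) - f (a + h *: w) + f a =
    h ^+ 2 * 'D_w ('D_v f) (a + s *: v + t *: w)].
Proof.
move=> h0 df; have h00 : 0 <= (0:R) <= h by rewrite lexx ltW.
have hh : 0 <= h <= h by rewrite lexx ltW.
pose G x := f (x + h *: w) - f x.
have dG (s : R) : 0 <= s <= h -> derivable G (a + s *: v) v /\
    'D_v G (a + s *: v) =
      'D_v f (a + s *: v + h *: w) - 'D_v f (a + s *: v).
  move=> sh.
  have d1 := (df s h sh hh).1.
  have d2 : differentiable f (a + s *: v).
    by have := (df s 0 sh h00).1; rewrite scale0r addr0.
  have E : (fun x => f (x + h *: w)) = f \o shift (h *: w) by [].
  have dS : derivable (fun x => f (x + h *: w)) (a + s *: v) v.
    have := @diff_derivable _ _ _ f _ v d1.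
    by apply: derivable_eq_growth => t; rewrite addrA.
  have dSE : 'D_v (fun x => f (x + h *: w)) (a + s *: v) =
      'D_v f (a + s *: v + h *: w).
    by apply: derive_eq_growth => t; rewrite [in RHS]addrA.
  split; first by apply: derivableB; [exact: dS|exact: diff_derivable].
  by rewrite -dSE; apply: deriveB; [exact: dS|exact: diff_derivable].
have [s sh sE] := MVT_along G a v h h0 (fun s sh => (dG s sh).1).
have sh' : 0 <= s <= h by case/andP: sh => ? ?; rewrite !ltW.
have [t th tE] := MVT_along ('D_v f) (a + s *: v) w h h0
  (fun t th => @diff_derivable _ _ _ _ _ w (df s t sh' th).2).
exists s, t; split => //.
move: sE; rewrite (dG s sh').2 tE /G mulrA -expr2 => <-; ring.
Qed.
End Schwarz.

Section SchwarzPartial.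
Context {R : realType} {n : nat}.

Lemma norm_delta_mx_le1 (i : 'I_n) : `|delta_mx ord0 i : 'rV[R]_n| <= 1.
Proof.
by apply: norm_le_coord => // j; rewrite mxE normr_nat lern1 leq_b1.
Qed.

(** Both mixed derivatives, at two points close to a, are equal to the same
    second difference quotient. *)
Lemma partialC {Omega : set 'rV[R]_n} {f : 'rV[R]_n -> R} i j {a} :
  open Omega -> smooth_on Omega f -> Omega a ->
  partial i (partial j f) a = partial j (partial i f) a.
Proof.
move=> oO sf Oa.
pose A := partial i (partial j f); pose B := partial j (partial i f).
have cA : {for a, continuous A}.
  by apply: differentiable_continuous; apply: (sf [:: i; j]).
have cB : {for a, continuous B}.
  by apply: differentiable_continuous; apply: (sf [:: j; i]).
apply/eqP; rewrite -subr_eq0 -normr_le0; apply/ler_addgt0Pr => e e0.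
rewrite add0r.
have e20 : 0 < e / 2 by rewrite divr_gt0.
have /cvgrPdist_lt/(_ _ e20) nA := cA.
have /cvgrPdist_lt/(_ _ e20) nB := cB.
have /nbhs_ballP[r /= r0 rP] : nbhs a (Omega `&`
    ([set x | `|A a - A x| < e / 2] `&` [set x | `|B a - B x| < e / 2])).
  have nO : nbhs a Omega by exact: open_nbhs_nbhs.
  exact: (@filterI _ _ (nbhs_filter a) _ _ nO (@filterI _ _ (nbhs_filter a) _ _ nA nB)).
(* two steps of length at most h stay inside the ball of radius r *)
pose h := r / 3.
have h0 : 0 < h by rewrite divr_gt0.
have inb k l s t : 0 <= s <= h -> 0 <= t <= h ->
    ball a r (a + s *: delta_mx ord0 k + t *: delta_mx ord0 l).
  move=> /andP[s0 sh] /andP[t0 th].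
  rewrite -ball_normE /= -addrA opprD addrA subrr add0r normrN.
  rewrite (le_lt_trans (ler_normD _ _))// !normrZ !ger0_norm//.
  have h1 := ler_wpM2l s0 (norm_delta_mx_le1 k).
  have h2 := ler_wpM2l t0 (norm_delta_mx_le1 l).
  by rewrite (le_lt_trans (lerD h1 h2))// !mulr1; rewrite /h in sh th; lra.
have H k l s t : 0 <= s <= h -> 0 <= t <= h ->
    differentiable f (a + s *: delta_mx ord0 k + t *: delta_mx ord0 l) /\
    differentiable (partial k f) (a + s *: delta_mx ord0 k + t *: delta_mx ord0 l).
  move=> sh th; have [Op _] := rP _ (inb k l s t sh th).
  by split; [exact: (sf [::])|exact: (sf [:: k])].
have [s [t [sh th sE]]] :=
  second_difference f a (delta_mx ord0 i) (delta_mx ord0 j) h h0 (H i j).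
have [s' [t' [sh' th' tE]]] :=
  second_difference f a (delta_mx ord0 j) (delta_mx ord0 i) h h0 (H j i).
have wk x : 0 < x < h -> 0 <= x <= h by case/andP => ? ?; rewrite !ltW.
have [_ [_ /= Bn]] := rP _ (inb i j s t (wk s sh) (wk t th)).
have [_ [/= An _]] := rP _ (inb j i s' t' (wk s' sh') (wk t' th')).
have AB : A (a + s' *: delta_mx ord0 j + t' *: delta_mx ord0 i) =
          B (a + s *: delta_mx ord0 i + t *: delta_mx ord0 j).
  have h20 : h ^+ 2 != 0 by rewrite gt_eqF// exprn_gt0.
  apply: (mulfI h20); rewrite -[RHS]sE -[LHS]tE.
  by rewrite [a + h *: delta_mx ord0 j + _]addrAC; ring.
rewrite -/(A a) -/(B a).
rewrite (_ : A a - B a =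
  (A a - A (a + s' *: delta_mx ord0 j + t' *: delta_mx ord0 i)) -
  (B a - B (a + s *: delta_mx ord0 i + t *: delta_mx ord0 j))); last first.
  by rewrite AB opprB addrA subrK.
move: An Bn; set p := A _; set q := B (a + _ + _) => An Bn.
apply: le_trans (ler_normB _ _) _.
by rewrite [leRHS]splitr; apply: ltW; apply: ltrD; [exact: An|exact: Bn].
Qed.
End SchwarzPartial.

(** * Bump functions and the fundamental lemma of the calculus of variations *)

Section Bump.
Context {R : realType}.

(** The smooth functions t^-m exp (-1/t), extended by 0 to t <= 0.  They are
    considered together because differentiation combines them
    ([is_derive_theta]). *)
Definition theta (m : nat) (t : R) : R :=
  if 0 < t then t^-1 ^+ m * expR (- t^-1) else 0.

(** exp (1/t) dominates t^-(m+2) / (m+2)!.  The quadratic bound makes [theta]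
    differentiable at 0, with derivative 0. *)
Lemma theta_le m t : `|theta m t| <= (m.+2)`!%:R * t ^+ 2.
Proof.
rewrite /theta; case: ifPn => [t0|_]; last by rewrite normr0 mulr_ge0// sqr_ge0.
rewrite ger0_norm; last by rewrite mulr_ge0 ?expR_ge0// exprn_ge0// invr_ge0 ltW.
have F0 : 0 < (m.+2)`!%:R :> R by rewrite ltr0n fact_gt0.
rewrite expRN -(@ler_pM2r _ (expR t^-1)) ?expR_gt0// mulfVK; last first.
  by rewrite gt_eqF// expR_gt0.
have := @expR_ge1Dxn R t^-1 m.+1 (ltW (_ : 0 < t^-1)); rewrite invr_gt0 => /(_ t0).
move=> H; have {}H : t^-1 ^+ m.+2 / (m.+2)`!%:R <= expR t^-1.
  by apply: le_trans H; rewrite lerDr.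
rewrite -ler_pdivrMl; last by rewrite mulr_gt0// exprn_gt0.
apply: le_trans H; rewrite le_eqVlt; apply/orP; left; apply/eqP.
rewrite invfM !exprS; field.
by rewrite !gt_eqF.
Qed.

Lemma theta_ge0 m t : 0 <= theta m t.
Proof.
rewrite /theta; case: ifPn => // t0.
by rewrite mulr_ge0 ?expR_ge0// exprn_ge0// invr_ge0 ltW.
Qed.

Lemma is_derive_theta m (t : R) :
  is_derive t 1 (theta m) (- m%:R * theta m.+1 t + 1 * theta m.+2 t).
Proof.
have [t0|t0|t0] := ltgtP t 0.
- have n0 : \near t, (fun=> 0) t = theta m t.
    have := lt_nbhsl t0; apply: filterS => y /= y0.
    by rewrite /theta ltNge ltW.
  apply: near_eq_is_derive n0 _.
  rewrite /theta ltNge ltW//= !mulr0 addr0; exact: is_derive_cst.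
- pose f (y : R) := y^-1 ^+ m * expR (- y^-1).
  have n0 : \near t, f t = theta m t.
    have := lt_nbhsr t0; apply: filterS => y /= y0.
    by rewrite /theta y0.
  apply: near_eq_is_derive n0 _.
  have dV : is_derive t 1 (fun y : R => y^-1) (- (t^-1 ^+ 2)).
    have tn0 : (fun y : R => y) t != 0 by rewrite gt_eqF.
    have did : derivable (fun y : R => y) t 1 by exact: derivable_id.
    apply: DeriveDef; first exact: (derivableV tn0 did).
    rewrite (deriveV tn0 did).
    by rewrite [X in _ *: X]derive_id exprVn /GRing.scale/= mulr1.
  have dX : is_derive t 1 (fun y : R => y^-1 ^+ m) (m%:R * t^-1 ^+ m.-1 * (- (t^-1 ^+ 2))).
    have -> : (fun y : R => y^-1 ^+ m) = (fun y => y^-1) ^+ m.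
      by apply/funext => z; rewrite exprfctE.
    exact: (is_deriveX m dV).
  have dE : is_derive t 1 (fun y : R => expR (- y^-1)) (expR (- t^-1) * (t^-1 ^+ 2)).
    have dN : is_derive t 1 (fun y : R => - y^-1) (t^-1 ^+ 2).
      by apply: is_derive_eq; rewrite opprK.
    apply: (@is_derive1_comp _ expR (fun y : R => - y^-1)).
  have dM := is_deriveM dX dE.
  have -> : f = (fun y : R => y^-1 ^+ m) * (fun y : R => expR (- y^-1)) by [].
  apply: (is_derive_eq dM).
  rewrite /theta t0 /GRing.scale/=; clear -t0; case: m => [|m].
    by rewrite !mul0r oppr0 !mul0r mulr0 addr0 add0r expr0 !mul1r mulrC.
  by rewrite /= !exprS; ring.
- rewrite t0 {t0}.
  have c0 : h^-1 *: (theta m (h *: 1 + 0) - theta m 0) @[h --> (0:R)^'] --> (0:R).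
    have th0 : theta m 0 = 0 by rewrite /theta ltxx.
    pose C : R := (m.+2)`!%:R.
    apply/cvgr0Pnorm_le => e e0.
    have C0 : 0 < C by rewrite ltr0n fact_gt0.
    have : \forall h \near (0:R)^', `|h| < e / C.
      by apply: dnbhs0_lt; rewrite divr_gt0.
    apply: filterS => h he.
    have [->|h0] := eqVneq h 0; first by rewrite invr0 scale0r normr0 ltW.
    rewrite addr0 [h *: 1]mulr1 th0 subr0 normrZ normfV.
    rewrite ler_pdivrMl ?normr_gt0//.
    apply: le_trans (theta_le m h) _; rewrite -/C -real_normK ?num_real// expr2.
    rewrite mulrCA ler_wpM2l// -ler_pdivlMl// mulrC; exact: ltW.
  have z0 : - m%:R * theta m.+1 0 + 1 * theta m.+2 0 = 0.
    by rewrite /theta ltxx !mulr0 addr0.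
  rewrite z0; apply: DeriveDef; first by apply/cvg_ex; exists 0.
  exact: cvg_lim c0.
Qed.
End Bump.

Section TestFunctions.
Context {R : realType} {n : nat}.
Implicit Types (a x : 'rV[R]_n) (w g : 'rV[R]_n -> R) (Omega K : set 'rV[R]_n).

Lemma compact_norm_bounded {K} : compact K -> exists M : R, forall x, K x -> `|x| <= M.
Proof.
move=> /compact_bounded[M [_ hM]]; exists (M + 1) => x Kx.
by apply: (hM (M + 1)) => //; rewrite ltrDl.
Qed.

Lemma closed_rV_compact {K} : compact K -> closed K.
Proof. by apply: compact_closed; exact: norm_hausdorff. Qed.

(** Outside K the product is locally 0, so that continuity of g on Omega is
    enough. *)
Lemma Cc_mul_test {Omega K g w} : open Omega -> compact K -> K `<=` Omega ->
  (forall x, Omega x -> {for x, continuous g}) -> continuous w ->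
  (forall x, ~ K x -> w x = 0) -> Cc n (fun x => g x * w x).
Proof.
move=> oO cK KO cg cw w0; split.
  move=> x; have [Kx|Kx] := pselect (K x).
    by apply: continuousM; [apply: cg; exact: KO|exact: cw].
  have oK : open (~` K) by rewrite openC; exact: closed_rV_compact.
  have N : {near x, (fun=> 0) =1 (fun x => g x * w x)}.
    have := open_nbhs_nbhs (conj oK Kx); apply: filterS => y Ky.
    by rewrite w0// mulr0.
  rewrite /continuous_at w0// mulr0.
  exact: cvg_trans (near_eq_cvg N) (cvg_cst _).
have [M KM] := compact_norm_bounded cK.
exists M => x Mx; rewrite w0 ?mulr0// => /KM; by rewrite leNgt Mx.
Qed.

Lemma integral_on_Cc {Omega} {h : 'rV[R]_n -> R} : open Omega -> Cc n h ->
  (forall x, ~ Omega x -> h x = 0) -> integral_on Omega h = (integralRn n h)%:E.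
Proof.
move=> oO hcc h0; rewrite /integral_on -integralRnE// integral_mkcond.
congr (integral _ _ _); apply/funext => t; rewrite patchE; case: ifPn => //.
by rewrite notin_setE => /= /h0 ->.
Qed.

Lemma integrable_on_Cc Omega (h : 'rV[R]_n -> R) : open Omega -> Cc n h ->
  integrable_on Omega h.
Proof.
move=> oO hcc; apply: (@integrableS _ _ _ _ setT) => //.
  exact: measurable_open_row.
exact: Cc_integrable.
Qed.

(** The squared Euclidean distance is a polynomial, which makes smoothness
    immediate; the support is the Euclidean ball of radius r. *)
Definition bump a (r : R) x : R := theta 0 (r ^+ 2 - \sum_i (x ord0 i - a ord0 i) ^+ 2).

Lemma smooth_bump Omega a r : open Omega -> smooth_on Omega (bump a r).
Proof.
move=> oO; rewrite /bump.
apply: (smooth_comp_family oO theta setT (fun m => - m%:R) (fun=> 1)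
  (fun x => r ^+ 2 - \sum_i (x ord0 i - a ord0 i) ^+ 2) _ _ _ 0) => //.
  by move=> m y _; exact: is_derive_theta.
apply: smoothB => //; first exact: smooth_cst.
apply: smooth_sum => // i; apply: smoothX => //; apply: smoothB => //.
  exact: smooth_coord.
exact: smooth_cst.
Qed.

(** The norm here is the sup norm, which the Euclidean norm dominates. *)
Lemma bump_support a r x : 0 <= r -> r < `|x - a| -> bump a r x = 0.
Proof.
move=> r0 rx; rewrite /bump /theta ifF//; apply/negbTE; rewrite -leNgt subr_le0.
have [i ri] : exists i, r < `|(x - a) ord0 i|.
  apply/not_existsP => H; move: rx; apply/negP; rewrite -leNgt.
  apply: norm_le_coord => // i; rewrite leNgt; apply/negP; exact: H.
rewrite (bigD1 i)//=; rewrite ler_wpDr ?sumr_ge0// => [j _|]; first exact: sqr_ge0.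
move: ri; rewrite !mxE => ri.
by rewrite -[leRHS]real_normK ?num_real// lerXn2r ?nnegrE// ltW.
Qed.

Lemma bump_center_gt0 a r : 0 < r -> 0 < bump a r a.
Proof.
move=> r0; rewrite /bump big1 ?subr0; last by move=> i _; rewrite subrr expr0n.
by rewrite /theta exprn_gt0// expr0 mul1r expR_gt0.
Qed.

Lemma test_bump Omega a : open Omega -> Omega a ->
  exists2 r, 0 < r & test_function Omega (bump a r).
Proof.
move=> oO Oa; have /nbhs_ballP[e /= e0 eO] := open_nbhs_nbhs (conj oO Oa).
exists (e / 2); first by rewrite divr_gt0.
split; first by apply: smooth_bump; exact: openT.
exists [set x | `|x - a| <= e / 2]; split.
- apply: bounded_closed_compact.
    exists (`|a| + e / 2); split; first exact: num_real.
    move=> M hM x /= xa; apply: le_trans (ltW hM).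
    by rewrite -[x](subrK a) addrC (le_trans (ler_normD _ _))// lerD2l.
  apply: (@closed_comp _ _ (fun x : 'rV[R]_n => `|x - a|) [set y : R | y <= e / 2]).
    move=> x _; apply: (@continuous_comp _ _ _ (fun x => x - a) (fun x => `|x|)).
      apply: continuousB => //; exact: cst_continuous.
    exact: norm_continuous.
  exact: closed_le.
- move=> x /= xa; apply: eO; rewrite -ball_normE/= distrC.
  by rewrite (le_lt_trans xa)// ltr_pdivrMr// ltr_pMr// ltr1n.
- move=> x /= /negP; rewrite -ltNge => xa; apply: bump_support => //.
  by rewrite divr_ge0// ltW.
Qed.

(** By continuity h is at least h a / 2 on a box around a, and boxes have
    positive measure. *)
Lemma integralRn_gt0 (h : 'rV[R]_n -> R) a : Cc n h -> (forall x, 0 <= h x) -> 0 < h a ->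
  0 < integralRn n h.
Proof.
move=> hcc h0 ha.
have ha2 : 0 < h a / 2 by rewrite divr_gt0.
have /cvgrPdist_lt/(_ _ ha2) N := hcc.1 a.
have /nbhs_ballP[e /= e0 eP] : nbhs a [set x | `|h a - h x| < h a / 2] by exact: N.
pose B : set (n.-tuple (measurableTypeR R)) :=
  [set t | forall i, tnth t i \in `[a ord0 i - e / 2, a ord0 i + e / 2]].
have mB : measurable B.
  rewrite (_ : B = \bigcap_(i in [set: 'I_n])
   ((fun t : n.-tuple (measurableTypeR R) => tnth t i) @^-1`
     `[a ord0 i - e / 2, a ord0 i + e / 2])).
    apply: fin_bigcap_measurable => // i _.
    have mI : @measurable _ (measurableTypeR R) `[a ord0 i - e / 2, a ord0 i + e / 2].
      exact: measurable_itv.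
    by have := @measurable_tnth _ (measurableTypeR R) n i measurableT _ mI;
      rewrite setTI.
  by apply/seteqP; split=> [t H i _|t H i]; [exact: H|exact: (H i)].
have BV : lebesgue_tuple B = (\prod_(i < n) (a ord0 i + e / 2 - (a ord0 i - e / 2)))%:E.
  by apply: lebesgue_tuple_box => i; rewrite lerD2l ge0_cp// divr_ge0// ltW.
have mh := Cc_measurable n h hcc.1.
rewrite -lte_fin -integralRnE//.
apply: (@lt_le_trans _ _ (\int[@lebesgue_tuple R n]_(t in B) (h a / 2)%:E)%E).
  rewrite integral_cst// [X in (_ * X)%E]BV -EFinM lte_fin mulr_gt0//.
  by apply: prodr_gt0 => i _; rewrite subr_gt0; lra.
apply: (@le_trans _ _ (\int[@lebesgue_tuple R n]_(t in B) (h (row_of_tuple t))%:E)%E).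
  apply: ge0_le_integral => //.
  - by move=> t _; rewrite lee_fin ltW.
  - exact: measurable_funTS.
  - move=> t tB; rewrite lee_fin.
    have : ball a e (row_of_tuple t).
      split => // i j; rewrite (ord1 i) /ball/= !mxE.
      have := tB j; rewrite in_itv/= => /andP[t1 t2].
      by rewrite ltr_norml; apply/andP; split; lra.
    move=> /eP/=; rewrite ltr_norml => /andP[_]; lra.
apply: ge0_subset_integral => //.
by move=> t _; rewrite lee_fin.
Qed.

(** If g a is not 0, the bump is taken with support in the open set where g has
    the sign of g a; then g a * g * bump is nonnegative and positive at a, so
    its integral cannot be 0. *)
Lemma fundamental_lemma {Omega g} : open Omega ->
  (forall x, Omega x -> {for x, continuous g}) ->
  (forall w, test_function Omega w -> integralRn n (fun x => g x * w x) = 0) ->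
  forall x, Omega x -> g x = 0.
Proof.
move=> oO cg g0 a Oa; apply/eqP; apply: contraT => ga0.
pose U := Omega `&` [set x | 0 < g a * g x].
have oU : open U.
  rewrite openE => x [Ox gx]; apply: filterI; first exact: open_nbhs_nbhs.
  have : {for x, continuous (fun y => g a * g y)}.
    by apply: continuousM; [exact: cst_continuous|exact: cg].
  by move/cvgr_gt; exact.
have Ua : U a by split => //; rewrite /= -expr2 exprn_even_gt0.
have [r r0 [sb [K [cK KU b0]]]] := test_bump U a oU Ua.
have KO : K `<=` Omega by move=> x /KU[].
have cb : continuous (bump a r).
  by move=> x; apply: differentiable_continuous; exact: smooth_diff sb I.
have ccg : Cc n (fun x => g x * bump a r x) by exact: Cc_mul_test oO cK KO cg cb b0.
have := integralRn_gt0 (fun x => g a * (g x * bump a r x)) a (CcZ n (g a) _ ccg).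
rewrite integralRnZ// g0 ?mulr0 ?ltxx; last by split => //; exists K.
apply.
  move=> x; have [/KU[_ gx]|Kx] := pselect (K x); last by rewrite b0// !mulr0.
  by rewrite mulrA mulr_ge0//; [exact: ltW|exact: theta_ge0].
by rewrite mulrA mulr_gt0//; [case: Ua|exact: bump_center_gt0].
Qed.
End TestFunctions.

(** * Derivatives of the double-well potential *)

Section DoubleWell.
Context {R : realType}.

Definition double_well1 (s : R) : R := s * (1 - s) * (1 - 2 * s).
Definition double_well2 (s : R) : R := 1 - 6 * s + 6 * s ^+ 2.

Lemma is_derive_double_well (s : R) : is_derive s 1 (@double_well R) (double_well1 s).
Proof.
pose p : {poly R} := 2^-1 *: ('X^2 * (1 - 'X) ^+ 2).
have -> : @double_well R = horner p.
  by apply/funext => t; rewrite /p /double_well !hornerE.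
apply: (is_derive_eq (is_derive_poly p s)).
rewrite /p derivZ derivM derivXn deriv_exp derivB derivX derivC /=.
by rewrite !hornerE /= /double_well1; field.
Qed.

Lemma is_derive_double_well1 (s : R) : is_derive s 1 double_well1 (double_well2 s).
Proof.
pose p : {poly R} := 'X * (1 - 'X) * (1 - 2 *: 'X).
have -> : double_well1 = horner p.
  by apply/funext => t; rewrite /p /double_well1 !hornerE.
apply: (is_derive_eq (is_derive_poly p s)).
rewrite /p !(derivM, derivB, derivZ, derivX, derivC) !hornerE /= /double_well2; ring.
Qed.
End DoubleWell.

(** * Expansions of order two, uniform on a set *)

Section Jets.
Context {R : realType} {X : Type} {K : set X}.
Implicit Types (f g r : R -> X -> R) (a b c : X -> R).

Definition ubnd f := exists C : R, \forall s \near (0 : R), forall x, K x -> `|f s x| <= C.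

Lemma ubndD {f g} : ubnd f -> ubnd g -> ubnd (fun s x => f s x + g s x).
Proof.
move=> [C hC] [D hD]; exists (C + D); apply: filterS2 hC hD => s hC hD x Kx.
by rewrite (le_trans (ler_normD _ _))// lerD ?hC ?hD.
Qed.

Lemma ubndM {f g} : ubnd f -> ubnd g -> ubnd (fun s x => f s x * g s x).
Proof.
move=> [C hC] [D hD]; exists (C * D); apply: filterS2 hC hD => s hC hD x Kx.
by rewrite normrM ler_pM ?hC ?hD.
Qed.

Lemma ubndN {f} : ubnd f -> ubnd (fun s x => - f s x).
Proof. by move=> [C hC]; exists C; apply: filterS hC => s h x; rewrite normrN; exact: h. Qed.

Lemma ubnd_const (k : R) : ubnd (fun _ _ => k).
Proof. by exists `|k|; near=> s. Unshelve. all: by end_near. Qed.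

Lemma ubnd_var : ubnd (fun s _ => s).
Proof.
exists 1; have := @nbhs0_le R R^o 1 ltr01; apply: filterS => s h x _; exact: h.
Qed.

Lemma ubnd_ext {f g} : (\forall s \near (0 : R), forall x, K x -> f s x = g s x) ->
  ubnd f -> ubnd g.
Proof.
move=> fg [C hC]; exists C; apply: filterS2 fg hC => s fg h x Kx.
by rewrite -fg// h.
Qed.

(** The functions a and b are the value and the derivative in s at s = 0, and
    the remainder is O(s^2) uniformly on K.  This class is stable under the ring
    operations and under inversion, so that the energy density is differentiated
    by algebra alone. *)
Definition jet f a b := [/\ ubnd (fun=> a), ubnd (fun=> b) &
  exists2 r, ubnd r & \forall s \near (0 : R), forall x, K x ->
    f s x = a x + s * b x + s ^+ 2 * r s x].

Lemma jet_ext {f g a b a' b'} :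
  (\forall s \near (0 : R), forall x, K x -> f s x = g s x) ->
  (forall x, K x -> a x = a' x) -> (forall x, K x -> b x = b' x) ->
  jet f a b -> jet g a' b'.
Proof.
move=> fg aa bb [ba b_b [r br fr]]; split.
- by apply: ubnd_ext ba; near=> s; exact: aa.
- by apply: ubnd_ext b_b; near=> s; exact: bb.
- exists r => //; apply: filterS2 fg fr => s fg fr x Kx.
  by rewrite -fg// fr// aa// bb.
Unshelve. all: by end_near. Qed.

Lemma jet_affine {a b} : ubnd (fun=> a) -> ubnd (fun=> b) ->
  jet (fun s x => a x + s * b x) a b.
Proof.
move=> ba b_b; split => //; exists (fun _ _ => 0); first exact: ubnd_const.
by near=> s => x _; rewrite mulr0 addr0.
Unshelve. all: by end_near. Qed.

Lemma jet_const {a} : ubnd (fun=> a) -> jet (fun _ x => a x) a (fun=> 0).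
Proof.
move=> ba; have := jet_affine ba (ubnd_const 0).
by apply: jet_ext => //; near=> s => x _; rewrite mulr0 addr0.
Unshelve. all: by end_near. Qed.

Lemma jetD {f g a b a' b'} : jet f a b -> jet g a' b' ->
  jet (fun s x => f s x + g s x) (fun x => a x + a' x) (fun x => b x + b' x).
Proof.
move=> [ba b_b [r br fr]] [ba' b_b' [r' br' gr]].
split; [exact: ubndD|exact: ubndD|exists (fun s x => r s x + r' s x)]; first exact: ubndD.
by apply: filterS2 fr gr => s fr gr x Kx; rewrite fr// gr//; ring.
Qed.

Lemma jetM {f g a b a' b'} : jet f a b -> jet g a' b' ->
  jet (fun s x => f s x * g s x) (fun x => a x * a' x)
      (fun x => b x * a' x + a x * b' x).
Proof.
move=> [ba b_b [r br fr]] [ba' b_b' [r' br' gr]].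
split; [exact: ubndM|by apply: ubndD; exact: ubndM|].
exists (fun s x => b x * b' x + (r s x * a' x + a x * r' s x) +
  s * (b x * r' s x + r s x * b' x) + s * s * (r s x * r' s x)).
  have bs := ubnd_var.
  by do ![exact: ubndM|apply: ubndD|apply: ubndM].
by apply: filterS2 fr gr => s fr gr x Kx; rewrite fr// gr//; ring.
Qed.

Lemma jetZ (k : R) {f a b} : jet f a b ->
  jet (fun s x => k * f s x) (fun x => k * a x) (fun x => k * b x).
Proof.
move=> jf; have := jetM (jet_const (ubnd_const k)) jf.
by apply: jet_ext => //; [near=> s|move=> x _; rewrite mul0r add0r].
Unshelve. all: by end_near. Qed.

Lemma jetB {f g a b a' b'} : jet f a b -> jet g a' b' ->
  jet (fun s x => f s x - g s x) (fun x => a x - a' x) (fun x => b x - b' x).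
Proof.
move=> jf jg; have := jetD jf (jetZ (-1) jg).
by apply: jet_ext => //; [near=> s => x _|move=> x _|move=> x _]; rewrite mulN1r.
Unshelve. all: by end_near. Qed.

Lemma jet_sum {m} {f : 'I_m -> R -> X -> R} {a b : 'I_m -> X -> R} :
  (forall i, jet (f i) (a i) (b i)) ->
  jet (fun s x => \sum_i f i s x) (fun x => \sum_i a i x) (fun x => \sum_i b i x).
Proof.
elim: m f a b => [|m IH] f a b jf.
  have := jet_const (ubnd_const 0).
  by apply: jet_ext; [near=> s => x _|move=> x _|move=> x _]; rewrite big_ord0.
have := jetD (jf ord0) (IH _ _ _ (fun i => jf (lift ord0 i))).
by apply: jet_ext; [near=> s => x _|move=> x _|move=> x _]; rewrite big_ord_recl.
Unshelve. all: by end_near. Qed.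

(** Keeps the denominators of the density, and the gradient of u + s w, away
    from 0 for small s. *)
Lemma jet_lower {f a b} {k : R} : 0 < k -> (forall x, K x -> k <= a x) -> jet f a b ->
  \forall s \near (0 : R), forall x, K x -> k / 2 <= f s x.
Proof.
move=> k0 ka [_ [C hC] [r [D hD] fr]].
have hC' x : K x -> `|b x| <= C by move=> Kx; exact: (nbhs_singleton hC).
have h1 : \forall s \near (0 : R), `|s| <= 1 by exact: (@nbhs0_le R R^o 1 ltr01).
have C1 : 0 < `|C| + `|D| + 1 by rewrite ltr_wpDl// addr_ge0.
have h2 : \forall s \near (0 : R), `|s| <= k / 2 / (`|C| + `|D| + 1).
  by apply: (@nbhs0_le R R^o); rewrite !divr_gt0.
near=> s => x Kx.
have s1 : `|s| <= 1 by near: s.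
have s2 : `|s| <= k / 2 / (`|C| + `|D| + 1) by near: s.
have hDs : forall x, K x -> `|r s x| <= D by near: s.
have frs : forall x, K x -> f s x = a x + s * b x + s ^+ 2 * r s x by near: s.
rewrite frs//.
have b1 : `|s * b x| <= `|s| * `|C|.
  by rewrite normrM ler_wpM2l// (le_trans (hC' x Kx))// ler_norm.
have b2 : `|s ^+ 2 * r s x| <= `|s| * `|D|.
  rewrite expr2 -mulrA normrM ler_wpM2l// normrM.
  by rewrite -[leRHS]mul1r; apply: ler_pM => //; exact: le_trans (hDs x Kx) (ler_norm _).
have b3 : `|s| * (`|C| + `|D| + 1) <= k / 2 by rewrite -ler_pdivlMr.
have := ka x Kx.
have := ler_norm (- (s * b x)); have := ler_norm (- (s ^+ 2 * r s x)).
rewrite !normrN; move: b1 b2 b3; rewrite !mulrDr mulr1.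
have := normr_ge0 s; lra.
Unshelve. all: by end_near. Qed.

Lemma jetV {f a b} {k : R} : 0 < k -> (forall x, K x -> k <= a x) -> jet f a b ->
  jet (fun s x => (f s x)^-1) (fun x => (a x)^-1) (fun x => - b x * (a x)^-1 ^+ 2).
Proof.
move=> k0 ka jf; have low := jet_lower k0 ka jf.
have [ba b_b [r br fr]] := jf.
have ubV g (l : R) : 0 < l -> (\forall s \near (0 : R), forall x, K x -> l <= g s x) ->
    ubnd (fun s x => (g s x)^-1).
  move=> l0 gl; exists l^-1; apply: filterS gl => s gl x Kx.
  have gp : 0 < g s x by rewrite (lt_le_trans l0)// gl.
  by rewrite gtr0_norm ?invr_gt0// lef_pV2 ?posrE// gl.
have baV : ubnd (fun _ x => (a x)^-1) by apply: (ubV _ k) => //; near=> s.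
have bfV : ubnd (fun s x => (f s x)^-1) by apply: (ubV _ (k / 2)) => //; rewrite divr_gt0.
have baV2 : ubnd (fun _ x => (a x)^-1 ^+ 2) by apply: ubndM.
split => //; first by apply: ubndM => //; exact: ubndN.
(* remainder obtained by reducing 1/f - 1/a + s b/a^2 to a common
   denominator *)
exists (fun s x => ((b x * b x - a x * r s x) + s * (b x * r s x)) *
   ((f s x)^-1 * (a x)^-1 ^+ 2)).
  have bs := ubnd_var.
  apply: ubndM; last exact: (ubndM bfV baV2).
  apply: ubndD; last by apply: ubndM => //; exact: ubndM.
  by apply: ubndD; [exact: ubndM|apply: ubndN; exact: ubndM].
apply: filterS2 low fr => s low fr x Kx.
have f0 : f s x != 0 by rewrite gt_eqF// (lt_le_trans _ (low x Kx))// divr_gt0.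
have a0 : a x != 0 by rewrite gt_eqF// (lt_le_trans _ (ka x Kx)).
apply: (mulIf f0); rewrite mulVf//.
have : forall y, (a x)^-1 * f s x + s * (- b x * (a x)^-1 ^+ 2) * f s x +
    s ^+ 2 * (y * (a x)^-1 ^+ 2) =
    ((a x)^-1 + s * (- b x * (a x)^-1 ^+ 2) + s ^+ 2 * (y * ((f s x)^-1 * (a x)^-1 ^+ 2))) * f s x.
  by move=> y; field; rewrite ?a0 ?f0.
by move=> <-; rewrite fr//; field; rewrite ?a0.
Unshelve. all: by end_near. Qed.

End Jets.
Arguments ubnd {R X} K f.
Arguments jet {R X} K f a b.

(** * Pointwise computation of the first variation *)

Section Algebra.
Context {R : realType} {m : nat}.
Implicit Types (F G : 'I_m -> 'I_m -> R) (a b : 'I_m -> R).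

Definition sum2 F := \sum_i \sum_j F i j.

Lemma eq_sum2 F G : (forall i j, F i j = G i j) -> sum2 F = sum2 G.
Proof. by move=> FG; apply: eq_bigr => i _; apply: eq_bigr => j _. Qed.

Lemma sum2D F G : sum2 (fun i j => F i j + G i j) = sum2 F + sum2 G.
Proof. by rewrite -big_split; apply: eq_bigr => i _; rewrite -big_split. Qed.

Lemma sum2Z c F : sum2 (fun i j => c * F i j) = c * sum2 F.
Proof. by rewrite mulr_sumr; apply: eq_bigr => i _; rewrite mulr_sumr. Qed.

Lemma sum2_prod a b : sum2 (fun i j => a i * b j) = (\sum_i a i) * (\sum_j b j).
Proof. by rewrite /sum2 big_distrlr. Qed.

Lemma sum2C F : sum2 (fun i j => F j i) = sum2 F.
Proof. exact: exchange_big. Qed.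

Variables (eps psi psi2 w rho : R) (v q : 'I_m -> R) (H h : 'I_m -> 'I_m -> R).
Hypotheses (eps0 : eps != 0) (rho1 : rho ^+ 2 * (\sum_k v k ^+ 2) = 1).
Hypothesis symH : forall i j, H i j = H j i.

Let nu i := rho * v i.
Let tau := \sum_k nu k * q k.
Let A i j := eps * H i j - eps^-1 * psi * (nu i * nu j).
Let A1 i j := eps * h i j - eps^-1 * (psi2 * w * (nu i * nu j)
  + psi * rho * (q i * nu j + nu i * q j) - 2 * psi * rho * tau * (nu i * nu j)).
Let hh := sum2 (fun i j => H i j * (nu i * nu j)).
Let b i := \sum_j rho * (H j i - nu i * \sum_k nu k * H j k) * nu j.

Lemma sum_nu2 : \sum_k nu k ^+ 2 = 1.
Proof.
by rewrite -rho1 mulr_sumr; apply: eq_bigr => k _; rewrite /nu exprMn.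
Qed.

(** b is the tangential part of rho H nu. *)
Lemma sum_bq : \sum_i b i * q i =
  rho * sum2 (fun i j => H i j * (q i * nu j)) - rho * tau * hh.
Proof.
have -> : \sum_i b i * q i = sum2 (fun i j => rho * (H j i * (q i * nu j)) +
   (- rho) * ((nu i * q i) * (nu j * \sum_k nu k * H j k))).
  apply: eq_bigr => i _; rewrite /b mulr_suml; apply: eq_bigr => j _; ring.
rewrite sum2D !sum2Z sum2_prod -/tau (eq_sum2 _ (fun i j => H i j * (q i * nu j))).
  have -> : \sum_j nu j * (\sum_k nu k * H j k) = hh.
    apply: eq_bigr => j _; rewrite mulr_sumr; apply: eq_bigr => k _; ring.
  by ring.
by move=> i j; rewrite symH.
Qed.

(** Here H and h stand for the Hessians of u and of the test function w, q for
    grad w, tau for nu . q, hh for nu . H nu, and b for (grad nu) nu.  Splitting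
    q along nu and its complement, the normal parts cancel, and the tangential
    part of A nu is a multiple of b. *)
Lemma first_variation_alg : sum2 (fun i j => A i j * A1 i j) =
  eps * sum2 (fun i j => A i j * h i j)
  - eps^-1 * psi2 * w * (eps * hh - eps^-1 * psi) - 2 * psi * \sum_i b i * q i.
Proof.
pose c1 := eps^-1 * (psi2 * w - 2 * psi * rho * tau).
pose c2 := eps^-1 * (psi * rho).
have -> : sum2 (fun i j => A i j * A1 i j) =
  sum2 (fun i j => eps * (A i j * h i j) +
   ((- c1 * eps) * (H i j * (nu i * nu j)) +
   ((c1 * eps^-1 * psi) * (nu i ^+ 2 * nu j ^+ 2) +
   ((- c2 * eps) * (H i j * (q i * nu j)) +
   ((- c2 * eps) * (H j i * (q j * nu i)) +
   ((c2 * eps^-1 * psi) * ((nu i * q i) * nu j ^+ 2) +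
   (c2 * eps^-1 * psi) * (nu i ^+ 2 * (nu j * q j)))))))).
  by apply: eq_sum2 => i j; rewrite (symH j i) /A1 /A /c1 /c2; ring.
rewrite !(sum2D, sum2Z) (sum2C (fun i j => H i j * (q i * nu j))).
rewrite !sum2_prod !sum_nu2 -/tau -/hh sum_bq /c1 /c2.
by field.
Qed.
End Algebra.

Section Pointwise.
Context {R : realType} {n : nat}.
Implicit Types (u w : 'rV[R]_n -> R).

Definition gradsq u x : R := \sum_k partial k u x ^+ 2.
Definition rgrad u x : R := (Num.sqrt (gradsq u x))^-1.
Definition nrm u (i : 'I_n) x : R := rgrad u x * partial i u x.

Lemma unit_gradE u x i : unit_grad u x ord0 i = nrm u i x.
Proof.
rewrite /unit_grad !mxE /nrm /rgrad /euclidean_norm /gradsq; congr (_^-1 * _).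
by congr Num.sqrt; apply: eq_bigr => k _; rewrite mxE.
Qed.

Lemma gradsq_gt0 {u x} : grad u x != 0 -> 0 < gradsq u x.
Proof.
move=> g0; rewrite lt0r; apply/andP; split; last by apply: sumr_ge0 => i _; exact: sqr_ge0.
apply: contraNneq g0 => /eqP; rewrite psumr_eq0; last by move=> i _; exact: sqr_ge0.
move=> /allP h; apply/eqP/rowP => i; rewrite !mxE.
by have /(_ (mem_index_enum _)) := h i; rewrite sqrf_eq0 => /eqP.
Qed.

Context {Omega : set 'rV[R]_n} (oO : open Omega) {eps : R} (eps0 : eps != 0).
Context {u : 'rV[R]_n -> R}.
Hypothesis su : smooth_on Omega u.
Hypothesis gu : forall x, Omega x -> grad u x != 0.

Let v i := partial i u.
Let H i j := partial i (partial j u).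
Local Notation nu := (nrm u).
Definition W1 x := double_well1 (u x).
Definition W2 x := double_well2 (u x).
Definition deficit i j x :=
  eps * partial i (partial j u) x - eps^-1 * W1 x * (nu i x * nu j x).
(** The components of (grad nu) nu. *)
Definition accel i x := \sum_j partial j (nu i) x * nu j x.
Definition div_nu x := \sum_i partial i (nu i) x.
Definition chem x := W1 x - eps ^+ 2 * laplacian u x.
(** The vector field Z of the introduction, whose divergence contains all the
    fourth and third order terms of the gradient. *)
Definition flux j x : R :=
  - eps^-1 * (partial j chem x + W1 x * (div_nu x * nu j x - accel j x)).
Definition nhess x := \sum_i \sum_j partial i (partial j u) x * (nu i x * nu j x).
Definition curvB x :=
  \sum_i partial i (fun y => div_nu y * nu i y) x - \sum_i partial i (accel i) x.
(** The L2-gradient, written as - eps^-1 times the right-hand side of the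
    phase field equation. *)
Definition mugnai_grad x : R :=
  - eps^-1 * (laplacian chem x - (eps ^+ 2)^-1 * W2 x * chem x + W1 x * curvB x).

(** The derivative at s = 0 of the deficit of u + s w.  The last term comes from
    the derivative of |grad (u + s w)|^-2. *)
Definition deficit_var (w : 'rV[R]_n -> R) i j x :=
  eps * partial i (partial j w) x -
  eps^-1 * (W2 x * w x * (nu i x * nu j x)
    + W1 x * rgrad u x * (partial i w x * nu j x + nu i x * partial j w x)
    - 2 * W1 x * rgrad u x * (\sum_k nu k x * partial k w x) * (nu i x * nu j x)).

Lemma smooth_v i : smooth_on Omega (v i).
Proof. exact: smooth_partial. Qed.
Lemma smooth_H i j : smooth_on Omega (H i j).
Proof. by do 2 apply: smooth_partial. Qed.
Lemma smooth_gradsq : smooth_on Omega (gradsq u).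
Proof. by apply: smooth_sum => // k; apply: smoothX => //; exact: smooth_v. Qed.
Lemma smooth_rgrad : smooth_on Omega (rgrad u).
Proof.
apply: (smooth_rsqrt oO (gradsq u) 1); last exact: smooth_gradsq.
by move=> x Ox; apply: gradsq_gt0; exact: gu.
Qed.
Lemma smooth_nrm i : smooth_on Omega (nu i).
Proof. by apply: smoothM => //; [exact: smooth_rgrad|exact: smooth_v]. Qed.
Lemma smooth_W1 : smooth_on Omega W1.
Proof.
rewrite /W1 /double_well1; do ![apply: smoothM => //|apply: smoothB => //];
  try exact: smooth_cst.
Qed.
Lemma smooth_W2 : smooth_on Omega W2.
Proof.
rewrite /W2 /double_well2; apply: smoothD => //; first apply: smoothB => //.
- exact: smooth_cst.
- exact: smoothZ.
- by apply: smoothZ => //; exact: smoothX.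
Qed.
Lemma smooth_deficit i j : smooth_on Omega (deficit i j).
Proof.
apply: smoothB => //; first by apply: smoothZ => //; exact: smooth_H.
apply: smoothM => //; first by apply: smoothZ => //; exact: smooth_W1.
by apply: smoothM => //; exact: smooth_nrm.
Qed.
Lemma smooth_accel i : smooth_on Omega (accel i).
Proof.
apply: smooth_sum => // j; apply: smoothM => //; last exact: smooth_nrm.
by apply: smooth_partial; exact: smooth_nrm.
Qed.
Lemma smooth_div_nu : smooth_on Omega div_nu.
Proof.
by apply: smooth_sum => // j; apply: smooth_partial; exact: smooth_nrm.
Qed.
Lemma smooth_laplacian : smooth_on Omega (laplacian u).
Proof. by apply: smooth_sum => // i; exact: smooth_H. Qed.
Lemma smooth_chem : smooth_on Omega chem.
Proof.
by apply: smoothB => //; [exact: smooth_W1|apply: smoothZ => //; exact: smooth_laplacian].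
Qed.
Lemma smooth_flux j : smooth_on Omega (flux j).
Proof.
apply: smoothZ => //; apply: smoothD => //.
  by apply: smooth_partial; exact: smooth_chem.
apply: smoothM => //; first exact: smooth_W1.
apply: smoothB => //; last exact: smooth_accel.
by apply: smoothM => //; [exact: smooth_div_nu|exact: smooth_nrm].
Qed.
Lemma smooth_mugnai_grad : smooth_on Omega mugnai_grad.
Proof.
apply: smoothZ => //; apply: smoothD => //; first apply: smoothB => //.
- by apply: smooth_sum => // i; do 2 apply: smooth_partial; exact: smooth_chem.
- apply: smoothM => //; last exact: smooth_chem.
  by apply: smoothZ => //; exact: smooth_W2.
apply: smoothM => //; first exact: smooth_W1.
apply: smoothB => //; apply: smooth_sum => // i; apply: smooth_partial.
  by apply: smoothM => //; [exact: smooth_div_nu|exact: smooth_nrm].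
exact: smooth_accel.
Qed.

Section At.
Context {x : 'rV[R]_n} (Ox : Omega x).

Lemma rgrad2 : rgrad u x ^+ 2 * gradsq u x = 1.
Proof.
have g0x := gradsq_gt0 (gu x Ox).
by rewrite /rgrad exprVn sqr_sqrtr ?ltW// mulVf// gt_eqF.
Qed.

Lemma rgrad_neq0 : rgrad u x != 0.
Proof. by rewrite invr_eq0 gt_eqF// sqrtr_gt0 gradsq_gt0//; exact: gu. Qed.

Lemma sum_nu_sq : \sum_k nu k x ^+ 2 = 1.
Proof. exact: (sum_nu2 (rgrad u x) (v ^~ x) rgrad2). Qed.

Lemma hessian_sym i j : H i j x = H j i x.
Proof. exact: partialC oO su Ox. Qed.

Let dv i : differentiable (v i) x. Proof. exact: smooth_diff (smooth_v i) Ox. Qed.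
Let dpsi : differentiable W1 x. Proof. exact: smooth_diff smooth_W1 Ox. Qed.
Let dnu i : differentiable (nu i) x. Proof. exact: smooth_diff (smooth_nrm i) Ox. Qed.
Let dH i j : differentiable (H i j) x. Proof. exact: smooth_diff (smooth_H i j) Ox. Qed.
Let db i : differentiable (accel i) x. Proof. exact: smooth_diff (smooth_accel i) Ox. Qed.
Let dd : differentiable div_nu x. Proof. exact: smooth_diff smooth_div_nu Ox. Qed.

Lemma partial_gradsq j : partial j (gradsq u) x = 2 * \sum_k v k x * H j k x.
Proof.
rewrite partial_sum; last first.
  by move=> k; apply: (@differentiableM _ _ (v k) (v k)); exact: dv.
rewrite mulr_sumr; apply: eq_bigr => k _.
have -> : (fun y => partial k u y ^+ 2) = (fun y => v k y * v k y) by [].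
by rewrite partialM//; rewrite /H /v; ring.
Qed.

(** Only the square of |grad u| is differentiated, through the chain rule for
    the inverse square root. *)
Lemma partial_rgrad j : partial j (rgrad u) x =
  - rgrad u x ^+ 3 * \sum_k v k x * H j k x.
Proof.
have g0x := gradsq_gt0 (gu x Ox).
have s0 : Num.sqrt (gradsq u x) != 0 by rewrite gt_eqF// sqrtr_gt0.
have dsq := is_derive1_sqrt g0x.
have [d1 d2] := dsq.
have dV := derivableV s0 d1; have dVE := deriveV s0 d1.
have dg : differentiable (gradsq u) x by exact: smooth_diff smooth_gradsq Ox.
rewrite (@partial_comp1 _ _ (fun y => (Num.sqrt y)^-1) (gradsq u))//.
rewrite dVE d2 partial_gradsq /rgrad /GRing.scale/=; field.
by rewrite s0.
Qed.

Lemma partial_nu i j : partial j (nu i) x =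
  rgrad u x * (H j i x - nu i x * \sum_k nu k x * H j k x).
Proof.
have dr : differentiable (rgrad u) x by exact: smooth_diff smooth_rgrad Ox.
rewrite /nrm (partialM dr (dv i)) partial_rgrad -/(v i).
have -> : \sum_k rgrad u x * partial k u x * H j k x =
    rgrad u x * \sum_k v k x * H j k x.
  by rewrite mulr_sumr; apply: eq_bigr => k _; rewrite mulrA.
by rewrite -/(H j i x); ring.
Qed.

Lemma partial_W1 j : partial j W1 x = W2 x * v j x.
Proof.
have [d1 d2] := is_derive_double_well1 (u x).
by rewrite partial_comp1// ?d2//; exact: smooth_diff su Ox.
Qed.

Lemma accelE i : accel i x =
  \sum_j rgrad u x * (H j i x - nu i x * \sum_k nu k x * H j k x) * nu j x.
Proof. by apply: eq_bigr => j _; rewrite partial_nu. Qed.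

Lemma div_nuE : div_nu x = rgrad u x * (laplacian u x - nhess x).
Proof.
rewrite /div_nu /laplacian /nhess -sumrB mulr_sumr; apply: eq_bigr => i _.
rewrite partial_nu; congr (_ * (_ - _)); rewrite mulr_sumr.
by apply: eq_bigr => j _; rewrite /H; ring.
Qed.

(** nu has constant length, so its derivatives are orthogonal to it. *)
Lemma nu_dot_accel : \sum_i accel i x * nu i x = 0.
Proof.
under eq_bigr do rewrite accelE.
have := sum_bq (rgrad u x) (v ^~ x) (nu ^~ x) (fun i j => H i j x) hessian_sym.
rewrite /= => ->.
rewrite (_ : \sum_k _ = 1); last by rewrite -sum_nu_sq; apply: eq_bigr => k _; rewrite expr2.
by rewrite mulr1 subrr.
Qed.

(** The gradient of u only sees the normal component |grad u| div nu, which is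
    the Laplacian minus the second normal derivative. *)
Lemma grad_dot_curvature :
  \sum_j v j x * (div_nu x * nu j x - accel j x) = laplacian u x - nhess x.
Proof.
have r0 := rgrad_neq0.
apply: (mulfI r0); rewrite -div_nuE mulr_sumr.
transitivity (\sum_j (div_nu x * nu j x ^+ 2 - accel j x * nu j x)).
  by apply: eq_bigr => j _; rewrite /nrm /v; ring.
by rewrite sumrB nu_dot_accel subr0 -mulr_sumr sum_nu_sq mulr1.
Qed.

(** Symmetry of second derivatives, for u and for its partial derivatives. *)
Lemma partial_laplacian j : partial j (laplacian u) x = \sum_i partial i (H i j) x.
Proof.
rewrite partial_sum; last by move=> k; exact: dH.
apply: eq_bigr => i _.
transitivity (partial i (partial j (v i)) x).
  exact: (partialC j i oO (smooth_v i) Ox).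
apply: (partial_in oO Ox) => y; rewrite inE => Oy.
exact: (partialC j i oO su Oy).
Qed.

(** The third derivatives of u combine with grad (W'(u)) into grad mu, and
    div (W'(u) nu (x) nu) splits into its gradient, curvature and (grad nu) nu
    parts. *)
Lemma div_deficit j : \sum_i partial i (deficit i j) x =
  flux j x - 2 * eps^-1 * W1 x * accel j x.
Proof.
have E i : partial i (deficit i j) x = eps * partial i (H i j) x
   - eps^-1 * (W2 x * v i x * nu i x * nu j x + W1 x * partial i (nu i) x * nu j x
     + W1 x * (partial i (nu j) x * nu i x)).
  have dnn : differentiable (fun y => nu i y * nu j y) x by exact: differentiableM.
  have dps : differentiable (fun y => eps^-1 * W1 y) x.
    by apply: differentiableM => //; exact: differentiable_cst.
  have deH : differentiable (fun y => eps * H i j y) x.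
    by apply: differentiableM => //; exact: differentiable_cst.
  have dpn : differentiable (fun y => eps^-1 * W1 y * (nu i y * nu j y)) x.
    exact: (differentiableM dps dnn).
  rewrite /deficit (partialB deH dpn) (partialZ (dH i j)).
  rewrite (partialM dps dnn) (partialZ dpsi).
  rewrite (partialM (dnu i) (dnu j)) partial_W1.
  move: (partial i (H i j) x) (partial i (nu j) x) (partial i (nu i) x).
  move: (W1 x) (W2 x) (v i x) (nu i x) (nu j x) => *; ring.
under eq_bigr do rewrite E.
rewrite sumrB -!mulr_sumr !big_split/= -partial_laplacian.
have -> : \sum_i W2 x * v i x * nu i x * nu j x = W2 x * v j x.
  transitivity (W2 x * v j x * \sum_i nu i x ^+ 2).
    by rewrite mulr_sumr; apply: eq_bigr => i _; rewrite /nrm -/(v i) -/(v j);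
      move: (rgrad u x) (W2 x) (v i x) (v j x) => *; ring.
  by rewrite sum_nu_sq mulr1.
have -> : \sum_i W1 x * partial i (nu i) x * nu j x = W1 x * div_nu x * nu j x.
  by rewrite /div_nu mulr_sumr mulr_suml.
rewrite -mulr_sumr -/(accel j x).
have dl : differentiable (laplacian u) x by exact: smooth_diff smooth_laplacian Ox.
rewrite /flux /chem partialB//; last by apply: differentiableM => //; exact: differentiable_cst.
by rewrite partialZ// partial_W1; field.
Qed.

Lemma div_flux : \sum_j partial j (flux j) x =
  - eps^-1 * (laplacian chem x + W1 x * curvB x + W2 x * (laplacian u x - nhess x)).
Proof.
have E j : partial j (flux j) x = - eps^-1 * (partial j (partial j chem) x
   + W1 x * (partial j (fun y => div_nu y * nu j y) x - partial j (accel j) x)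
   + W2 x * (v j x * (div_nu x * nu j x - accel j x))).
  have dm : differentiable (partial j chem) x.
    by apply: smooth_diff Ox; apply: smooth_partial; exact: smooth_chem.
  have ddn : differentiable (fun y => div_nu y * nu j y) x by exact: differentiableM.
  have ddb : differentiable (fun y => div_nu y * nu j y - accel j y) x by exact: differentiableB.
  have dpd : differentiable (fun y => W1 y * (div_nu y * nu j y - accel j y)) x.
    by exact: differentiableM.
  rewrite /flux partialZ; last exact: differentiableD.
  rewrite partialD// [partial j (fun y => W1 y * _) x]partialM// partialB// partial_W1; ring.
under eq_bigr do rewrite E.
rewrite -mulr_sumr !big_split/= -!mulr_sumr sumrB grad_dot_curvature; congr (_ * _).
Qed.

(** The integrations by parts are done before integrating: for w of compact
    support the last sum is the divergence of a field of compact support. *)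
Lemma first_variation_pointwise {w : 'rV[R]_n -> R} : smooth_on Omega w ->
  eps^-1 * \sum_i \sum_j deficit i j x * deficit_var w i j x =
  mugnai_grad x * w x + \sum_i partial i
    (fun y => \sum_j deficit i j y * partial j w y - w y * flux i y) x.
Proof.
move=> sw.
have := first_variation_alg eps (W1 x) (W2 x) (w x) (rgrad u x) (v ^~ x)
  (fun i => partial i w x) (fun i j => H i j x) (fun i j => partial i (partial j w) x)
  eps0 rgrad2 hessian_sym.
rewrite /= /sum2 => E; rewrite [X in eps^-1 * X]E {E}.
have dw : differentiable w x by exact: smooth_diff sw Ox.
have dwj j : differentiable (partial j w) x.
  by apply: smooth_diff Ox; exact: smooth_partial.
have dA i j : differentiable (deficit i j) x by exact: smooth_diff (smooth_deficit i j) Ox.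
have dZ i : differentiable (flux i) x by exact: smooth_diff (smooth_flux i) Ox.
have dAw i j : differentiable (fun y => deficit i j y * partial j w y) x by exact: differentiableM.
have P i : partial i (fun y => \sum_j deficit i j y * partial j w y - w y * flux i y) x =
   \sum_j deficit i j x * partial i (partial j w) x + \sum_j partial j w x * partial i (deficit i j) x
   - (w x * partial i (flux i) x + partial i w x * flux i x).
  rewrite partialB; last exact: differentiableM.
    rewrite partial_sum// partialM//; congr (_ - (_ + _)); last exact: mulrC.
    by rewrite -big_split/=; apply: eq_bigr => j _; rewrite partialM.
  apply: smooth_diff Ox; apply: smooth_sum => // j; apply: smoothM => //.
    exact: smooth_deficit.
  exact: smooth_partial.
under [in RHS]eq_bigr do rewrite P.
rewrite sumrB !big_split/=.
rewrite (exchange_big _ _ _ _ _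
  (fun i j => partial j w x * partial i (deficit i j) x))/=.
have -> : \sum_j \sum_i partial j w x * partial i (deficit i j) x =
   \sum_j partial j w x * flux j x - 2 * eps^-1 * W1 x * \sum_j accel j x * partial j w x.
  rewrite mulr_sumr -sumrB; apply: eq_bigr => j _; rewrite -mulr_sumr div_deficit; ring.
rewrite -mulr_sumr div_flux /mugnai_grad.
have -> : \sum_i (\sum_j rgrad u x *
    (H j i x - rgrad u x * v i x * (\sum_k rgrad u x * v k x * H j k x)) *
    (rgrad u x * v j x)) * partial i w x =
  \sum_j accel j x * partial j w x.
  by apply: eq_bigr => i _; rewrite accelE.
rewrite -/(nhess x).
set s1 := \sum_i \sum_j deficit i j x * _.
have -> : chem x = W1 x - eps ^+ 2 * laplacian u x by [].
move: (\sum_j partial j w x * flux j x) (\sum_j accel j x * partial j w x) => s2 s3.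
move: (laplacian chem x) (laplacian u x) (curvB x) (W1 x) (W2 x) (nhess x) (w x) => *.
by field.
Qed.

End At.
End Pointwise.
Arguments W1 {R n} u x.
Arguments W2 {R n} u x.
Arguments deficit {R n} eps u i j x.
Arguments accel {R n} u i x.
Arguments div_nu {R n} u x.
Arguments chem {R n} eps u x.
Arguments flux {R n} eps u j x.
Arguments nhess {R n} u x.
Arguments curvB {R n} u x.
Arguments mugnai_grad {R n} eps u x.
Arguments deficit_var {R n} eps u w i j x.

(** * Expansion of the energy density *)

Section Density.
Context {R : realType} {n : nat}.
Implicit Types (u w : 'rV[R]_n -> R).

Definition density (eps : R) u (x : 'rV[R]_n) : R :=
  sq_norm_mx (eps *: hessian u x -
       (eps^-1 * derive1 (@double_well R) (u x)) *:
         tensor (unit_grad u x) (unit_grad u x)).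

Lemma derive1_double_well : derive1 (@double_well R) = double_well1.
Proof.
by apply/funext => s; rewrite derive1E; have [_] := is_derive_double_well s.
Qed.

Lemma derive1_double_well1 : derive1 (@double_well1 R) = double_well2.
Proof.
by apply/funext => s; rewrite derive1E; have [_] := is_derive_double_well1 s.
Qed.

Lemma densityE eps u x : density eps u x = \sum_i \sum_j deficit eps u i j x ^+ 2.
Proof.
apply: eq_bigr => i _; apply: eq_bigr => j _; congr (_ ^+ 2).
have tE : tensor (unit_grad u x) (unit_grad u x) i j = nrm u i x * nrm u j x.
  by rewrite mxE !unit_gradE.
have hE : hessian u x i j = partial i (partial j u) x by rewrite mxE.
rewrite derive1_double_well mxE [X in X + _]mxE hE; congr (_ + _).
by rewrite mxE; congr (- _); rewrite mxE tE.
Qed.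

Lemma density_ge0 eps u x : 0 <= density eps u x.
Proof. by do 2 (apply: sumr_ge0 => ? _); exact: sqr_ge0. Qed.

(** The components of nu occur in the density through products of two of them,
    which are rational in grad u: no square root has to be expanded in s. *)
Lemma rgrad_sq u x : rgrad u x ^+ 2 = (\sum_k partial k u x * partial k u x)^-1.
Proof.
rewrite /rgrad exprVn sqr_sqrtr; last by apply: sumr_ge0 => k _; exact: sqr_ge0.
by congr (_^-1); apply: eq_bigr => k _; rewrite expr2.
Qed.

Lemma nrmM u i j x : nrm u i x * nrm u j x =
  partial i u x * partial j u x * (\sum_k partial k u x * partial k u x)^-1.
Proof. by rewrite /nrm mulrACA -expr2 rgrad_sq mulrC. Qed.

Lemma ubnd_continuous {Omega K : set 'rV[R]_n} {f : 'rV[R]_n -> R} :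
  compact K -> K `<=` Omega -> (forall x, Omega x -> {for x, continuous f}) ->
  ubnd K (fun=> f).
Proof.
move=> cK KO cf.
have : compact (f @` K).
  apply: continuous_compact => //; apply: continuous_in_subspaceT => x.
  by rewrite inE => /KO; exact: cf.
move=> /compact_bounded[M [_ hM]]; exists (M + 1); near=> s => x Kx.
by apply: (hM (M + 1)); [rewrite ltrDl|exists x].
Unshelve. all: by end_near. Qed.

Context {Omega K : set 'rV[R]_n} (eps : R) {u w : 'rV[R]_n -> R}.
Hypotheses (oO : open Omega) (cK : compact K) (KO : K `<=` Omega) (eps0 : eps != 0).
Hypotheses (su : smooth_on Omega u) (sw : smooth_on setT w).
Hypothesis gu : forall x, Omega x -> grad u x != 0.
Hypothesis w0 : forall x, ~ K x -> w x = 0.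

Let us (s : R) := fun x => u x + s * w x.

Let sw' : smooth_on Omega w. Proof. by move=> s x _; exact: sw. Qed.

Lemma smooth_us s : smooth_on Omega (us s).
Proof. by apply: smoothD => //; exact: smoothZ. Qed.

Let partialDZ (f g : 'rV[R]_n -> R) s i x : smooth_on Omega f -> smooth_on Omega g ->
  Omega x -> partial i (fun y => f y + s * g y) x = partial i f x + s * partial i g x.
Proof.
move=> sf sg Ox; have df := smooth_diff sf Ox; have dg := smooth_diff sg Ox.
rewrite partialD ?partialZ//.
by apply: differentiableM => //; exact: differentiable_cst.
Qed.

Lemma partial_us s i x : Omega x -> partial i (us s) x = partial i u x + s * partial i w x.
Proof. exact: partialDZ. Qed.

Lemma partial2_us s i j x : Omega x ->
  partial i (partial j (us s)) x = partial i (partial j u) x + s * partial i (partial j w) x.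
Proof.
move=> Ox; rewrite -partialDZ//; try exact: smooth_partial.
apply: (partial_in oO Ox) => y; rewrite inE => Oy; exact: partial_us.
Qed.

Let ubs {f : 'rV[R]_n -> R} : smooth_on Omega f -> ubnd K (fun=> f).
Proof.
move=> sf; apply: (ubnd_continuous cK KO) => x Ox.
by apply: differentiable_continuous; exact: smooth_diff sf Ox.
Qed.

Let jet_grad i : jet K (fun s x => partial i u x + s * partial i w x) (partial i u) (partial i w).
Proof. by apply: jet_affine; apply: ubs; exact: smooth_partial. Qed.

Let q x := \sum_k partial k u x * partial k u x.

Let jet_gradsq : jet K
  (fun s x => \sum_k (partial k u x + s * partial k w x) * (partial k u x + s * partial k w x))
  q (fun x => \sum_k (partial k w x * partial k u x + partial k u x * partial k w x)).
Proof. by apply: jet_sum => k; apply: jetM. Qed.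

Let q_gt0 x : Omega x -> 0 < q x.
Proof. exact: (fun Ox => gradsq_gt0 (gu x Ox)). Qed.

(** The continuous function |grad u|^-2 is bounded on the compact set K. *)
Let q_lower : exists2 k, 0 < k & forall x, K x -> k <= q x.
Proof.
have sq : smooth_on Omega (fun x => rgrad u x ^+ 2).
  by apply: smoothX => //; exact: smooth_rgrad.
have [C hC] := ubs sq.
have C0 : 0 < `|C| + 1 by rewrite ltr_wpDl.
exists (`|C| + 1)^-1; first by rewrite invr_gt0.
move=> x Kx; rewrite -[leRHS]invrK lef_pV2 ?posrE// ?invr_gt0 ?q_gt0//; last exact: KO.
rewrite -rgrad_sq; have := nbhs_singleton hC x Kx.
by have := ler_norm (rgrad u x ^+ 2); have := ler_norm C; lra.
Qed.

(** On K by the lower bound, elsewhere because w vanishes around the point. *)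
Lemma near_grad_us : \forall s \near (0 : R), forall x, Omega x -> grad (us s) x != 0.
Proof.
have [k k0 kq] := q_lower.
have := jet_lower k0 kq jet_gradsq; apply: filterS => s low x Ox.
have gE i : grad (us s) x ord0 i = partial i u x + s * partial i w x.
  by rewrite mxE partial_us.
have [Kx|Kx] := pselect (K x).
  have := low x Kx; apply: contraTneq => g0; rewrite -ltNge big1 ?divr_gt0// => i _.
  by rewrite -gE g0 mxE mul0r.
suff -> : grad (us s) x = grad u x by exact: gu.
apply/rowP => i; rewrite gE mxE (partial_support i (closed_rV_compact cK) w0 x Kx).
by rewrite mulr0 addr0.
Qed.

Let jet_double_well1 : jet K (fun s x => double_well1 (us s x)) (W1 u) (fun x => W2 u x * w x).
Proof.
have jU : jet K us u w by apply: jet_affine; exact: ubs.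
have j1 := @jet_const _ _ K _ (ubnd_const (1 : R)).
have := jetM (jetM jU (jetB j1 jU))
  (jetB j1 (jetZ 2 jU)).
apply: jet_ext => //; first by near=> s.
by move=> x _; rewrite /W2 /double_well2; ring.
Unshelve. all: by end_near. Qed.

Lemma jet_deficit i j : jet K (fun s x => deficit eps (us s) i j x)
  (deficit eps u i j) (deficit_var eps u w i j).
Proof.
have [k k0 kq] := q_lower.
have jV := jetV k0 kq jet_gradsq.
have jH : jet K (fun s x => partial i (partial j u) x + s * partial i (partial j w) x)
    (partial i (partial j u)) (partial i (partial j w)).
  by apply: jet_affine; apply: ubs; do 2 apply: smooth_partial.
have := jetB (jetZ eps jH)
  (jetZ eps^-1 (jetM jet_double_well1
    (jetM (jetM (jet_grad i) (jet_grad j)) jV))).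
apply: jet_ext.
- near=> s => x /KO Ox; rewrite /deficit partial2_us// nrmM !partial_us//.
  rewrite -[_ * W1 _ x * _]mulrA; congr (_ - _ * (_ * (_ * _^-1))).
  by apply: eq_bigr => l _; rewrite partial_us.
- by move=> x _; rewrite /deficit nrmM -[_ * W1 _ x * _]mulrA.
- move=> x Kx; rewrite /deficit_var /nrm.
  have -> : \sum_l rgrad u x * partial l u x * partial l w x =
      rgrad u x * \sum_l partial l u x * partial l w x.
    by rewrite mulr_sumr; apply: eq_bigr => l _; rewrite mulrA.
  have -> : \sum_l (partial l w x * partial l u x + partial l u x * partial l w x) =
      2 * \sum_l partial l u x * partial l w x.
    by rewrite mulr_sumr; apply: eq_bigr => l _; ring.
  rewrite -/(q x) /q -rgrad_sq.
  move: (\sum_l partial l u x * partial l w x) (rgrad u x) (partial i u x) (partial j u x).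
  move: (partial i w x) (partial j w x) (partial i (partial j w) x) => *; ring.
Unshelve. all: by end_near. Qed.

Lemma jet_density : jet K (fun s => density eps (us s)) (density eps u)
  (fun x => 2 * \sum_i \sum_j deficit eps u i j x * deficit_var eps u w i j x).
Proof.
have := jet_sum (fun i => jet_sum (fun j =>
  jetM (jet_deficit i j) (jet_deficit i j))).
apply: jet_ext.
- near=> s => x _; rewrite densityE; apply: eq_bigr => i _; apply: eq_bigr => j _.
  by rewrite expr2.
- move=> x _; rewrite densityE; apply: eq_bigr => i _; apply: eq_bigr => j _.
  by rewrite expr2.
- move=> x _; rewrite mulr_sumr; apply: eq_bigr => i _; rewrite mulr_sumr.
  by apply: eq_bigr => j _; ring.
Unshelve. all: by end_near. Qed.

Lemma smooth_density {f} : smooth_on Omega f -> (forall x, Omega x -> grad f x != 0) ->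
  smooth_on Omega (density eps f).
Proof.
move=> sf gf; apply: (smooth_ext oO (fun x => \sum_i \sum_j deficit eps f i j x ^+ 2)).
  by move=> x _; rewrite densityE.
do 2 (apply: smooth_sum => // ?); apply: smoothX => //; exact: smooth_deficit.
Qed.

Lemma density_off s {x} : ~ K x -> density eps (us s) x = density eps u x.
Proof.
move=> Kx; have oK : open (~` K) by rewrite openC; exact: closed_rV_compact.
have uE : {in ~` K, us s =1 u}.
  by move=> y; rewrite inE => Ky; rewrite /us w0// mulr0 addr0.
have pE i : {in ~` K, partial i (us s) =1 partial i u}.
  by move=> y; rewrite inE => Ky; exact: (partial_in oK Ky uE).
have p2E i j : partial i (partial j (us s)) x = partial i (partial j u) x.
  exact: (partial_in oK Kx (pE j)).
have xK : x \in ~` K by rewrite inE.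
have gE : gradsq (us s) x = gradsq u x by apply: eq_bigr => k _; rewrite pE.
rewrite !densityE; apply: eq_bigr => i _; apply: eq_bigr => j _.
by rewrite /deficit /W1 /nrm /rgrad p2E uE// !pE// gE.
Qed.

End Density.

(** * The L2-gradient of Mugnai's energy *)

Section L2Gradient.
Context {R : realType} {n : nat}.
Context {Omega : set 'rV[R]_n} {eps : R} {u : 'rV[R]_n -> R}.
Hypotheses (oO : open Omega) (eps_gt0 : 0 < eps).
Hypotheses (su : smooth_on Omega u) (gu : forall x, Omega x -> grad u x != 0).

Let eps0 : eps != 0. Proof. by rewrite gt_eqF. Qed.
Let continuous_smooth {f : 'rV[R]_n -> R} : smooth_on Omega f ->
  forall x, Omega x -> {for x, continuous f}.
Proof. by move=> sf x Ox; apply: differentiable_continuous; exact: smooth_diff sf Ox. Qed.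

Lemma mugnai_energyE f : mugnai_energy Omega eps f =
  (((2 * eps)^-1)%:E * integral_on Omega (density eps f))%E.
Proof. by []. Qed.

(** The density is nonnegative and measurable, and the positive factor in front
    of the integral does not affect finiteness. *)
Lemma mugnai_energy_integrable : (mugnai_energy Omega eps u < +oo)%E ->
  integrable_on Omega (density eps u).
Proof.
rewrite mugnai_energyE => Foo.
have c0 : 0 < (2 * eps)^-1 by rewrite invr_gt0 mulr_gt0.
have mD := measurable_continuous_on n Omega (density eps u) oO
  (continuous_smooth (smooth_density eps oO su gu)).
apply/integrableP; split => //.
under eq_integral do rewrite gee0_abs ?lee_fin ?density_ge0//.
rewrite ltey; apply: contraTneq Foo => Ioo.
by rewrite /integral_on Ioo gt0_muley ?lte_fin// ltxx.
Qed.

Lemma Cc_partial {K : set 'rV[R]_n} {f : 'rV[R]_n -> R} i : compact K ->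
  (forall x, ~ K x -> f x = 0) -> smooth_on setT f -> Cc n (partial i f).
Proof.
move=> cK f0 sf.
have p0 := partial_support i (closed_rV_compact cK) f0.
split.
  move=> x; apply: differentiable_continuous.
  exact: smooth_diff (smooth_partial sf) I.
have [M KM] := compact_norm_bounded cK.
by exists M => x Mx; apply: p0 => /KM; rewrite leNgt Mx.
Qed.

Lemma integralRn_partial {K : set 'rV[R]_n} {f : 'rV[R]_n -> R} i : compact K ->
  (forall x, ~ K x -> f x = 0) -> smooth_on setT f -> integralRn n (partial i f) = 0.
Proof.
move=> cK f0 sf; apply: integralRn_partial_eq0.
- by move=> x; apply: diff_derivable; exact: smooth_diff sf I.
- exact: Cc_partial i cK f0 sf.
- have [M KM] := compact_norm_bounded cK.
  by exists M => x Mx; apply: f0 => /KM; rewrite leNgt Mx.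
Qed.

Section Test.
Context {w : 'rV[R]_n -> R} {K : set 'rV[R]_n}.
Hypotheses (sw : smooth_on setT w) (cK : compact K) (KO : K `<=` Omega).
Hypothesis w0 : forall x, ~ K x -> w x = 0.

Let cw : continuous w.
Proof. by move=> x; apply: differentiable_continuous; exact: smooth_diff sw I. Qed.
Let sw' : smooth_on Omega w. Proof. by move=> s x _; exact: sw. Qed.
Let clK : closed K. Proof. exact: closed_rV_compact. Qed.

Let X i y := \sum_j deficit eps u i j y * partial j w y - w y * flux eps u i y.

Let X0 i x : ~ K x -> X i x = 0.
Proof.
move=> Kx; rewrite /X w0// mul0r subr0 big1// => j _.
by rewrite (partial_support j clK w0)// mulr0.
Qed.

Let sX i : smooth_on setT (X i).
Proof.
apply: (smooth_extend0 clK KO) => //; first exact: X0.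
apply: smoothB => //; last by apply: smoothM => //; exact: smooth_flux.
apply: smooth_sum => // j; apply: smoothM => //; first exact: smooth_deficit.
exact: smooth_partial.
Qed.

Lemma Cc_grad_test : Cc n (fun x => mugnai_grad eps u x * w x).
Proof.
apply: (Cc_mul_test oO cK KO) => //; apply: continuous_smooth; exact: smooth_mugnai_grad.
Qed.

(** The first variation of the density, in the form where its integral is
    visible; it is globally defined, and [energy_varE] identifies it on K. *)
Definition energy_var x : R :=
  2 * eps * (mugnai_grad eps u x * w x + \sum_i partial i (X i) x).

Lemma Cc_energy_var : Cc n energy_var.
Proof.
apply: CcZ; apply: CcD; first exact: Cc_grad_test.
by apply: (integralRn_sum _ _ _ _).1 => i; exact: Cc_partial i cK (X0 i) (sX i).
Qed.

Lemma integralRn_energy_var :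
  (2 * eps)^-1 * integralRn n energy_var = integralRn n (fun x => mugnai_grad eps u x * w x).
Proof.
have [c1 E] := integralRn_sum n _ (fun i => partial i (X i))
  (fun i => Cc_partial i cK (X0 i) (sX i)).
rewrite integralRnZ; last by apply: CcD => //; exact: Cc_grad_test.
rewrite mulKf; last by rewrite mulf_neq0.
rewrite integralRnD//; last exact: Cc_grad_test.
rewrite E big1 ?addr0// => i _; exact: integralRn_partial i cK (X0 i) (sX i).
Qed.

Lemma energy_varE x : K x -> energy_var x =
  2 * \sum_i \sum_j deficit eps u i j x * deficit_var eps u w i j x.
Proof.
move=> /KO Ox; rewrite /energy_var.
rewrite -(first_variation_pointwise oO eps0 su gu Ox sw').
by rewrite -mulrA mulVKf.
Qed.

Lemma energy_var_off x : ~ K x -> energy_var x = 0.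
Proof.
move=> Kx; rewrite /energy_var w0// mulr0 add0r big1 ?mulr0// => i _.
exact: (partial_support i clK (X0 i) x Kx).
Qed.

Let us (s : R) := fun x => u x + s * w x.
Let D s x := density eps (us s) x - density eps u x.

Let D0 s x : ~ K x -> D s x = 0.
Proof. by move=> Kx; rewrite /D /us (density_off eps cK w0 s Kx) subrr. Qed.

Lemma near_Cc_density : \forall s \near (0 : R), Cc n (D s).
Proof.
have := near_grad_us oO cK KO su sw gu w0.
apply: filterS => s gs.
have sD : smooth_on setT (D s).
  apply: (smooth_extend0 clK KO) => //; first exact: D0.
  apply: smoothB => //; apply: smooth_density => //.
  exact: smooth_us.
split; first by move=> x; apply: differentiable_continuous; exact: smooth_diff sD I.
have [M KM] := compact_norm_bounded cK.
by exists M => x Mx; apply: D0 => /KM; rewrite leNgt Mx.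
Qed.

Lemma density_expansion : exists2 C : R, 0 <= C & \forall s \near (0 : R), forall x,
  `|D s x - s * energy_var x| <= C * s ^+ 2.
Proof.
have [_ _ [r [C rC] dE]] :=
  jet_density eps oO cK KO su sw gu.
exists `|C| => //; apply: filterS2 rC dE => s rC dE x.
have [Kx|Kx] := pselect (K x); last first.
  by rewrite D0// energy_var_off// mulr0 subrr normr0 mulr_ge0// sqr_ge0.
rewrite /D /us dE// energy_varE//.
set e := 2 * _; rewrite (_ : _ - _ = s ^+ 2 * r s x); last by ring.
rewrite normrM (ger0_norm (sqr_ge0 s)) mulrC ler_wpM2r ?sqr_ge0//.
exact: le_trans (rC x Kx) (ler_norm C).
Qed.

(** The quotient differs from the integral of the first variation by at most a
    constant times |s|, the remainder of the expansion being integrated over a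
    bounded set. *)
Lemma quotient_cvg : ((2 * eps)^-1 * integralRn n (D s)) / s @[s --> (0 : R)^'] -->
  integralRn n (fun x => mugnai_grad eps u x * w x).
Proof.
have [C C0 nC] := density_expansion.
have [M0 KM0] := compact_norm_bounded cK.
pose M := `|M0|; pose V := C * (2 * M) ^+ n.
have M_ge0 : 0 <= M by exact: normr_ge0.
have V0 : 0 <= V by rewrite mulr_ge0// exprn_ge0// mulr_ge0.
pose c := (2 * eps)^-1.
have c0 : 0 < c by rewrite invr_gt0 mulr_gt0.
(* the constant c * V + 1 bounds the remainder divided by |s|; the term 1
   keeps it positive *)
rewrite -integralRn_energy_var -/c; clearbody c; apply/cvgrPdist_le => e e0.
have W0 : 0 < c * V + 1 by rewrite ltr_wpDl// mulr_ge0// ltW.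
have nW : \forall s \near (0 : R)^', `|s| < e / (c * V + 1).
  by apply: dnbhs0_lt; rewrite divr_gt0.
near=> s.
have s0 : s != 0 by near: s; exact: nbhs_dnbhs_neq.
have ccs : Cc n (D s) by near: s; apply: nbhs_dnbhs; exact: near_Cc_density.
have hC : forall x, `|D s x - s * energy_var x| <= C * s ^+ 2.
  by near: s; exact: nbhs_dnbhs.
have hs : `|s| < e / (c * V + 1) by near: s.
have ccr : Cc n (fun x => D s x + (- s) * energy_var x).
  by apply: CcD => //; apply: CcZ; exact: Cc_energy_var.
have : `|integralRn n (fun x => D s x + (- s) * energy_var x)| <= (C * s ^+ 2) * (2 * M) ^+ n.
  apply: le_integralRn => //; first by rewrite mulr_ge0// sqr_ge0.
    move=> x Mx; have Kx : ~ K x.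
      by move=> /KM0; rewrite leNgt (le_lt_trans (ler_norm M0)).
    by rewrite D0// energy_var_off// mulr0 addr0.
  by move=> x; rewrite mulNr; exact: hC.
rewrite integralRnD//; last by apply: CcZ; exact: Cc_energy_var.
rewrite integralRnZ; last exact: Cc_energy_var.
set a := integralRn n (D s); set b := integralRn n energy_var => ab.
rewrite (_ : _ - _ = - (c / s * (a + - s * b))); last by field.
rewrite normrN !normrM normfV (gtr0_norm c0).
rewrite mulrAC ler_pdivrMr ?normr_gt0//.
apply: (@le_trans _ _ (c * (C * s ^+ 2 * (2 * M) ^+ n))).
  by rewrite ler_wpM2l// ltW.
rewrite (_ : c * _ = (c * V) * `|s| * `|s|); last first.
  by rewrite -[s ^+ 2]real_normK ?num_real// /V; ring.
rewrite ler_wpM2r//; apply: (@le_trans _ _ ((c * V + 1) * `|s|)).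
  by rewrite ler_wpM2r// lerDl.
by rewrite mulrC -ler_pdivlMr// ltW.
Unshelve. all: by end_near. Qed.

End Test.

(** The energies may be subtracted because that of u is finite and the density
    of u + s w differs from that of u by a function in C_c(R^n). *)
Theorem mugnai_L2_gradient : (mugnai_energy Omega eps u < +oo)%E ->
  is_L2_gradient Omega (mugnai_energy Omega eps) u (mugnai_grad eps u).
Proof.
move=> Foo w [sw [K [cK KO w0]]].
have ccg := Cc_grad_test sw cK KO w0.
split; first exact: integrable_on_Cc.
rewrite (integral_on_Cc oO ccg); last first.
  by move=> x Ox; rewrite w0 ?mulr0// => /KO.
have Iu := mugnai_energy_integrable Foo.
have mO := measurable_open_row n Omega oO.
have Ifin : integral_on Omega (density eps u) \is a fin_num by exact: integrable_fin_num.
pose D s x := density eps (fun x => u x + s * w x) x - density eps u x.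
pose h s := ((2 * eps)^-1 * integralRn n (D s)) / s.
have hcvg : (h s)%:E @[s --> (0 : R)^'] -->
    (integralRn n (fun x => mugnai_grad eps u x * w x))%:E.
  apply: cvg_EFin; first by near=> s.
  exact: (quotient_cvg sw cK KO w0).
apply: cvg_trans hcvg; apply: near_eq_cvg; near=> s.
have ccDs : Cc n (D s).
  near: s; apply: nbhs_dnbhs; exact: (near_Cc_density sw cK KO w0).
have ID : integrable_on Omega (D s) by exact: integrable_on_Cc.
have E : integral_on Omega (density eps (fun x => u x + s * w x)) =
    (integral_on Omega (density eps u) + (integralRn n (D s))%:E)%E.
  rewrite -(integral_on_Cc oO ccDs); last first.
    move=> x Ox; have Kx : ~ K x by move=> /KO.
    by rewrite /D (density_off eps cK w0 s Kx) subrr.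
  rewrite /integral_on -integralD//; apply: eq_integral => t _.
  by rewrite -EFinD /D addrC subrK.
have [z Iz] : exists z : R, integral_on Omega (density eps u) = z%:E.
  by exists (fine (integral_on Omega (density eps u))); rewrite fineK.
have F1 : mugnai_energy Omega eps u = ((2 * eps)^-1 * z)%:E.
  by rewrite mugnai_energyE Iz EFinM.
have F2 : mugnai_energy Omega eps (fun x => u x + s * w x) =
    ((2 * eps)^-1 * (z + integralRn n (D s)))%:E.
  by rewrite mugnai_energyE E Iz -EFinD EFinM.
rewrite [X in (X - _)%E]F2 [X in (_ - X)%E]F1 -EFinB -EFinM; congr EFin.
rewrite /h; move: (integralRn n (D s)) => c; ring.
Unshelve. all: by end_near. Qed.

End L2Gradient.

(** * The gradient flow and the phase field system *)

Section Flow.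
Context {R : realType} {n : nat}.
Implicit Types (u : 'rV[R]_n -> R).

Lemma curvature_termE u : curvature_term u = curvB u.
Proof.
apply/funext => x; rewrite /curvature_term /curvB.
have dE y : divergence (unit_grad u) y = div_nu u y.
  apply: eq_bigr => i _; congr (partial i _ y).
  by apply/funext => z; rewrite unit_gradE.
congr (_ - _); apply: eq_bigr => i _; congr (partial i _ x); apply/funext => y.
  by rewrite mxE dE unit_gradE.
rewrite /mx_apply /accel mxE mxE; apply: eq_bigr => j _.
rewrite mxE [X in _ * X]mxE unit_gradE.
by congr (partial j _ y * _); apply/funext => z; rewrite unit_gradE.
Qed.

Lemma mugnai_gradE (eps : R) u x : eps != 0 ->
  eps^-1 * mugnai_grad eps u x =
  - (eps ^+ 2)^-1 * (laplacian (chem eps u) x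
    - (eps ^+ 2)^-1 * double_well2 (u x) * chem eps u x
    + double_well1 (u x) * curvature_term u x).
Proof.
move=> e0; rewrite curvature_termE /mugnai_grad /W1 /W2.
set z := _ + _; field; exact: e0.
Qed.

Lemma laplacian_in {Omega : set 'rV[R]_n} {f g : 'rV[R]_n -> R} {x} : open Omega ->
  {in Omega, f =1 g} -> Omega x -> laplacian f x = laplacian g x.
Proof.
move=> oO fg Ox; apply: eq_bigr => i _.
apply: (partial_in oO Ox) => y; rewrite inE => Oy.
exact: (partial_in oO Oy fg).
Qed.

(** Limits are unique in the extended reals, so both candidates have the same
    integral against every test function. *)
Lemma L2_gradient_unique {Omega : set 'rV[R]_n} {F : ('rV[R]_n -> R) -> \bar R}
  {u} {f g : 'rV[R]_n -> R} : open Omega ->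
  (forall x, Omega x -> {for x, continuous f}) ->
  (forall x, Omega x -> {for x, continuous g}) ->
  is_L2_gradient Omega F u f -> is_L2_gradient Omega F u g ->
  forall x, Omega x -> f x = g x.
Proof.
move=> oO cf cg Ff Fg x Ox; apply/eqP; rewrite -subr_eq0; apply/eqP.
apply: (@fundamental_lemma _ _ _ (fun x => f x - g x) oO _ _ x Ox).
  by move=> y Oy; apply: continuousB; [exact: cf|exact: cg].
move=> w tw; have [_ lf] := Ff w tw; have [_ lg] := Fg w tw.
have [sw [K [cK KO w0]]] := tw.
have cw : continuous w.
  by move=> y; apply: differentiable_continuous; exact: smooth_diff sw I.
have ccf := Cc_mul_test oO cK KO cf cw w0.
have ccg := Cc_mul_test oO cK KO cg cw w0.
have off h y : ~ Omega y -> h y * w y = 0.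
  by move=> Oy; rewrite w0 ?mulr0// => /KO.
have : integral_on Omega (fun x => f x * w x) = integral_on Omega (fun x => g x * w x).
  exact: cvg_unique lf lg.
rewrite (integral_on_Cc oO ccf (off f)) (integral_on_Cc oO ccg (off g)).
move=> H; have fg := EFin_inj H.
have -> : (fun x => (f x - g x) * w x) = (fun x => f x * w x + (-1) * (g x * w x)).
  by apply/funext => y; ring.
by rewrite integralRnD ?integralRnZ//; [rewrite fg; ring|exact: CcZ].
Qed.

End Flow.

Theorem proposition3p6 (R : realType) (N : nat) (Omega : set 'rV[R]_N.+1)
    (eps : R) (I : set R) (u : R -> 'rV[R]_N.+1 -> R) :
  open Omega -> bounded_set Omega -> lipschitz_boundary Omega ->
  0 < eps ->
  admissible_evolution Omega (mugnai_energy Omega eps) I u ->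
  L2_gradient_flow Omega eps (mugnai_energy Omega eps) I u <->
  exists mu : R -> 'rV[R]_N.+1 -> R, phase_field_system Omega eps I u mu.
Proof.
move=> oO _ _ eps_gt0 adm; have eps0 : eps != 0 by rewrite gt_eqF.
have e20 : eps ^+ 2 != 0 by rewrite expf_neq0.
have grad_u t : I t ->
    is_L2_gradient Omega (mugnai_energy Omega eps) (u t) (mugnai_grad eps (u t)).
  by move=> It; have [su _ gu Fu] := adm t It; exact: mugnai_L2_gradient.
rewrite /phase_field_system derive1_double_well derive1_double_well1; split=> [flow|[mu sys]].
- exists (fun t => chem eps (u t)) => t x It Ox; split=> //.
  have [g gu gE] := flow t It.
  have [su du nu Fu] := adm t It.
  (* the flow equation turns the continuity of the time derivative into that
     of the gradient g *)
  have cg y : Omega y -> {for y, continuous g}.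
    move=> Oy; have E : {near y, (fun z => - eps * time_derivative u t z) =1 g}.
      have := open_nbhs_nbhs (conj oO Oy); apply: filterS => z Oz.
      by rewrite gE// mulrNN mulVKf.
    rewrite /prop_for /continuous_at -(nbhs_singleton E).
    have cE : {for y, continuous (fun z => - eps * time_derivative u t z)}.
      by apply: continuousM; [exact: cst_continuous|exact: (du y Oy).2].
    exact: cvg_trans (near_eq_cvg E) cE.
  have cG y : Omega y -> {for y, continuous (mugnai_grad eps (u t))}.
    move=> Oy; apply: differentiable_continuous.
    exact: smooth_diff (smooth_mugnai_grad oO su nu) Oy.
  rewrite gE// (L2_gradient_unique oO cg cG gu (grad_u t It) x Ox).
  by rewrite mugnai_gradE// mulrN mulNr mulrN opprK mulVKf.
- move=> t It; exists (mugnai_grad eps (u t)); first exact: grad_u.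
  move=> x Ox; have [E _] := sys t x It Ox.
  have muE : {in Omega, mu t =1 chem eps (u t)}.
    by move=> y; rewrite inE => Oy; have [_] := sys t y It Oy.
  rewrite mugnai_gradE// mulNr opprK -(laplacian_in oO muE Ox).
  by rewrite -muE ?inE// -E mulKf.
Qed.
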